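(* Let $\kappa = 1+\max_{k\in\mathcal K}\sum_{i\in\mathcal I} k_i$, and let $p<1$ satisfy $1-\kappa(1-p) > 7/8$ (equivalently $p > 1-\frac{1}{8\kappa}$). Consider the sequence of systems, with scaling parameter $r\to\infty$, operating under the GRAND($Z^p$) algorithm. For each $r$, let $x^r(\infty)$ denote the random state of the fluid-scaled process in the stationary regime. Then, as $r\to\infty$, $$d\big(x^r(\infty),\mathcal X^*\big)\Rightarrow 0 ,$$ i.e. the Euclidean distance from $x^r(\infty)$ to the set $\mathcal X^*$ of optimal solutions of the linear program (LP) converges to $0$ in distribution.
   Context: **Packing.** There are $I$ customer types, $\mathcal I=\{1,\dots,I\}$. $\bar{\mathcal K}\subset\mathbb Z_+^I$ is a finite set of (feasible) server configurations $k=(k_i)_{i\in\mathcal I}$, which is monotone: if $k\in\bar{\mathcal K}$, $k'\in\mathbb Z_+^I$ and $k'\le k$ componentwise, then $k'\in\bar{\mathcal K}$. All unit vectors $e_i$, $i\in\mathcal I$, belong to $\bar{\mathcal K}$. Let $\mathbf 0$ be the zero vector and $\mathcal K=\bar{\mathcal K}\setminus\{\mathbf 0\}$. A server is in configuration $k$ if it is currently serving exactly $k_i$ customers of type $i$ for each $i$. There are infinitely many servers. **System with parameter $r$.** Fix $\lambda_i>0,\mu_i>0$ and put $\rho_i=\lambda_i/\mu_i$, with $\sum_i\rho_i=1$. The scaling parameter $r>0$ increases to infinity along a discrete sequence. In the system with parameter $r$, type-$i$ customers arrive as independent Poisson processes of rate $\lambda_i r$; each customer is placed into a server immediately on arrival,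 and leaves after an exponential service time of mean $1/\mu_i$. All service times are independent of each other and of the arrivals, and are unaffected by which customers share a server. $X^r_k(t)$ is the number of servers in configuration $k\in\mathcal K$ at time $t$; the state is $X^r(t)=(X^r_k(t))_{k\in\mathcal K}$. Let $Y^r_i(t)=\sum_{k\in\mathcal K}k_iX^r_k(t)$ and $Z^r(t)=\sum_iY^r_i(t)$ (total number of customers). **GRAND($Z^p$) algorithm**, with parameter $p\in(0,1)$. At any time $t$ there are $X^r_{\mathbf 0}(t)=\lceil Z^r(t)^p\rceil$ designated empty servers (''zero-servers''). An arriving type-$i$ customer is placed into a server chosen uniformly at random among the zero-servers and the occupied servers that can still fit it, i.e. among $$X^r_{(i)}(t)=X^r_{\mathbf 0}(t)+\sum_{k\in\mathcal K:\,k+e_i\in\mathcal K}X^r_k(t)$$ servers; if $X^r_{(i)}(t)=0$ it is placed into an empty server. Thus $X^r(\cdot)$ is a continuous-time Markov chain on a countable state space; it is irreducible and positive recurrent, hence has a unique stationary distribution. $X^r(\infty)$ denotes a random state with that distribution. **Fluid scaling.** $x^r(t)=X^r(t)/r$ and $x^r(\infty)=X^r(\infty)/r$. **(LP).** Minimize $\sum_{k\in\mathcal K}x_k$ over $x\in\mathbb R^{|\mathcal K|}$ subject to $\sum_{k\in\mathcal K}k_ix_k=\rho_i$ for all $i\in\mathcal I$ and $x_k\ge0$ for all $k\in\mathcal K$. $\mathcal X^*$ is its set of optimal solutions. For a point $x$ and set $U$, $d(x,U)=\inf_{u\in U}\|x-u\|$ with the Euclidean norm. *)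

(* Defs.v *)
From HB Require Import structures.
From mathcomp Require Import all_boot all_order all_algebra finmap.
From mathcomp Require Import all_classical all_reals all_analysis.
Import Order.TTheory GRing.Theory Num.Theory.
Import numFieldNormedType.Exports.

Set Implicit Arguments.
Unset Strict Implicit.
Unset Printing Implicit Defensive.

Local Open Scope classical_set_scope.
Local Open Scope ring_scope.

Definition config (I : nat) : choiceType := {ffun 'I_I -> nat}.

Definition cfg0 (I : nat) : config I := [ffun=> 0%N].

Definition cfg_add (I : nat) (k : config I) (i : 'I_I) : config I :=
  [ffun j => (k j + (j == i))%N].

(* Truncated at 0; only used with [0 < k i]. *)
Definition cfg_sub (I : nat) (k : config I) (i : 'I_I) : config I :=
  [ffun j => (k j - (j == i))%N].

Definition unit_cfg (I : nat) (i : 'I_I) : config I := cfg_add (cfg0 I) i.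

Definition feasible_configs (I : nat) (Kbar : {fset config I}) : Prop :=
  (forall k k' : config I,
      k \in Kbar -> (forall i, (k' i <= k i)%N) -> k' \in Kbar) /\
  (forall i : 'I_I, unit_cfg i \in Kbar).

Definition nonzero_configs (I : nat) (Kbar : {fset config I}) :
  {fset config I} := (Kbar `\ cfg0 I)%fset.

Definition kappa (I : nat) (Kbar : {fset config I}) : nat :=
  (1 + \max_(k : nonzero_configs Kbar) \sum_(i < I) val k i)%N.

Definition state (I : nat) (Kbar : {fset config I}) : Type :=
  {ffun nonzero_configs Kbar -> nat}.

(* The countable state space carries the discrete sigma-algebra. *)
HB.instance Definition _ (I : nat) (Kbar : {fset config I}) :=
  Countable.copy (state Kbar) {ffun nonzero_configs Kbar -> nat}.
HB.instance Definition _ (I : nat) (Kbar : {fset config I}) :=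
  isPointed.Build (state Kbar) [ffun=> 0%N].
HB.instance Definition _ (I : nat) (Kbar : {fset config I}) :=
  @isMeasurable.Build default_measure_display (state Kbar)
    (@discrete_measurable (state Kbar)) (@discrete_measurable0 (state Kbar))
    (@discrete_measurableC (state Kbar)) (@discrete_measurableU (state Kbar)).

Section GRAND.
Context {R : realType} {I : nat} (Kbar : {fset config I}).
Let K := nonzero_configs Kbar.
Implicit Types (x : state Kbar) (a b : config I).

Definition total_customers x : nat :=
  (\sum_(i < I) \sum_(k : K) val k i * x k)%N.

Definition zero_servers (p : R) x : nat :=
  `|Num.ceil ((total_customers x)%:R `^ p)|%N.

Definition servers (p : R) x (k : config I) : nat :=
  if k == cfg0 I then zero_servers p x
  else if insub k is Some k' then x k' else 0%N.

Definition available (p : R) x (i : 'I_I) : nat :=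
  (zero_servers p x + \sum_(k : K | cfg_add (val k) i \in K) x k)%N.

(* Probability that an arriving type-[i] customer joins a server in
   configuration [k] (used only when [cfg_add k i \in Kbar]). *)
Definition placement_prob (p : R) x (i : 'I_I) (k : config I) : R :=
  if available p x i == 0%N then (k == cfg0 I)%:R
  else (servers p x k)%:R / (available p x i)%:R.

(* One server passes from configuration [a] to configuration [b]; empty servers
   are not a component of the state, so [a] or [b] equal to 0 has no effect. *)
Definition move_server x a b : state Kbar :=
  [ffun c : K => (x c - (val c == a) + (val c == b))%N].

(* [transition_sum g x] is the sum over all possible events in state [x] of
   (rate of the event) * g (state after the event). *)
Definition transition_sum (lambda mu : 'I_I -> R) (p r : R)
    (g : state Kbar -> R) x : R :=
  (\sum_(i < I) \sum_(k : Kbar | cfg_add (val k) i \in Kbar)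
     lambda i * r * placement_prob p x i (val k) *
       g (move_server x (val k) (cfg_add (val k) i))) +
  (\sum_(i < I) \sum_(k : K | (0 < val k i)%N)
     mu i * (val k i)%:R * (x k)%:R *
       g (move_server x (val k) (cfg_sub (val k) i))).

Definition grand_generator (lambda mu : 'I_I -> R) (p r : R)
    x (y : state Kbar) : R :=
  transition_sum lambda mu p r (fun z => (z == y)%:R) x
  - (x == y)%:R * transition_sum lambda mu p r (fun=> 1) x.

Definition lp_feasible (rho : 'I_I -> R) : set {ffun K -> R} :=
  [set x | (forall i, \sum_(k : K) (val k i)%:R * x k = rho i) /\
           (forall k, 0 <= x k)].

Definition lp_optimal (rho : 'I_I -> R) : set {ffun K -> R} :=
  [set x | lp_feasible rho x /\
           forall y, lp_feasible rho y -> \sum_(k : K) x k <= \sum_(k : K) y k].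

(* The library norm on finite products is the sup norm. *)
Definition euclidean_dist (x y : {ffun K -> R}) : R :=
  Num.sqrt (\sum_(k : K) (x k - y k) ^+ 2).

(* Real infimum: meaningful for nonempty [U]. *)
Definition dist_to_set (x : {ffun K -> R}) (U : set {ffun K -> R}) : R :=
  inf [set euclidean_dist x u | u in U].

Definition fluid_scaled (r : R) x : {ffun K -> R} := [ffun k => (x k)%:R / r].

Definition fluid_gap (rho : 'I_I -> R) (r : R) x : R :=
  dist_to_set (fluid_scaled r x) (lp_optimal rho).

Lemma measurable_fluid_gap (rho : 'I_I -> R) (r : R) :
  measurable_fun [set: state Kbar] (fluid_gap rho r).
Proof. by []. Qed.

HB.instance Definition _ (rho : 'I_I -> R) (r : R) :=
  isMeasurableFun.Build _ _ (state Kbar) R (fluid_gap rho r)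
    (measurable_fluid_gap rho r).

End GRAND.

(* [P] is the (honest, standard) transition semigroup of a continuous-time
   Markov chain on the countable discrete space [S] with transition-rate matrix
   [Q]; it is unique when [Q] is non-explosive. *)
Record ctmc_semigroup (d : measure_display) (S : measurableType d)
    (R : realType) (Q : S -> S -> R) (P : R -> R.-pker S ~> S) : Prop := {
  ctmc_init : forall (x : S) (A : set S), measurable A -> P 0 x A = \d_x A;
  ctmc_chapman_kolmogorov : forall (s t : R) (x : S) (A : set S),
    0 <= s -> 0 <= t -> measurable A ->
    P (s + t) x A = (\int[P s x]_y P t y A)%E;
  ctmc_rates : forall x y : S,
    ((fine (P t x [set y]) - (x == y)%:R) / t) @[t --> 0^'+] --> Q x y }.

Definition stationary_distribution (d : measure_display) (S : measurableType d)
    (R : realType) (P : R -> R.-pker S ~> S) (pi : probability S R) : Prop :=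
  forall (t : R) (A : set S), 0 <= t -> measurable A ->
    (\int[pi]_x P t x A)%E = pi A.

Definition cvg_in_distribution (R : realType) (mu : nat -> probability R R)
    (nu : probability R R) : Prop :=
  forall f : R -> R, continuous f -> bounded_fun f ->
    (\int[mu n]_x (f x)%:E)%E @[n --> \oo] --> (\int[nu]_x (f x)%:E)%E.

(* Main.v *)
Require Import Defs.
From HB Require Import structures.
From mathcomp Require Import all_boot all_order all_algebra finmap.
From mathcomp Require Import all_classical all_reals all_analysis.
From mathcomp Require Import measurable_realfun.
From mathcomp Require Import ring lra.
Import Order.TTheory GRing.Theory Num.Theory.
Import numFieldNormedType.Exports.
Local Open Scope classical_set_scope.
Local Open Scope ring_scope.

Set Implicit Arguments.
Unset Strict Implicit.
Unset Printing Implicit Defensive.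

(** Write [s = r `^ (1 / 8)].  The Lyapunov function is the entropy
    [sum_k (ln (X_k !) + X_k (ln (prod_i k_i !) - p ln r))] plus [s ^- 2] times
    a quadratic penalty for the deviation of the customer counts [Y_i] from
    their means [rho_i r].  Its drift is at most [- D - spread / (2 s ^+ 2)] up
    to [O(s ^+ 6)], where [D] is the symmetrised relative entropy between the
    arrival and departure flows along all pairs [(k, k + e_i)].  A stationary
    law therefore gives probability [O(1 / s)] to the states in which one of
    these terms exceeds [s ^+ 7].  Elsewhere, since the zero-servers number
    about [r `^ p], much more than [s ^+ 7], opposite flows are comparable, and
    [X_k] is within bounded factors of [r `^ p * prod_i exp (k_i nu_i)] with
    [nu_i = ln (rho_i r / X_(i))].  As [X_k = O(r)], [nu / ((1 - p) ln r)] is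
    almost dual feasible for (LP), and [X_k / r] is small unless the
    corresponding dual constraint is almost tight: by weak duality, [X / r] is
    almost optimal. *)

(** * Stationary laws and drift *)

(** The powers of [s] come from three competing orders. Besides minus the dissipation, the entropy
    drift contains [\sum_i skew_i * mu_i * imbalance_i], which has no sign: the entropy does not see
    [X_(i)], so the part of each log flow ratio that depends only on the type survives. It is of
    order [s * |imbalance_i|], the crude bound [ln r <= 8 s] being good enough there. The quadratic
    penalty absorbs it; with weight [s ^- 2] this costs [O(s ^+ 4)], while the random fluctuations
    of the customer counts cost [2 r / s ^+ 2 = 2 s ^+ 6], the dominant error. The next power,
    [s ^+ 7], defines the bad states, and it has to lie below every upward flow, which near balance
    is at least of order [r ^ p]: hence [p > 7 / 8]. Stationarity is available only through
    derivatives at 0 of single transition probabilities, and the Lyapunov function is not known to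
    be integrable. So only finitely supported test functions are used, for which an inequality
    suffices. Where the number of customers is far from [r], flows cannot be compared, and the
    penalty alone has to beat a crude bound on the entropy drift. *)

Section ContinuousTimeChains.
Context (R : realType) (d : measure_display) (S : measurableType d).
Hypothesis discreteS : forall A : set S, measurable A.

Lemma ge0_sum_le_integral (pi : probability S R) (f : S -> \bar R) (B : seq S) :
  (forall x, 0 <= f x)%E -> uniq B ->
  (\sum_(x <- B) pi [set x] * f x <= \int[pi]_x f x)%E.
Proof.
move=> f0 uB.
apply: (@le_trans _ _ (\int[pi]_(x in [set` B]) f x)%E); last first.
  by apply: ge0_subset_integral => //.
elim: B uB => [_|x B IH /= /andP[xB uB]].
  by rewrite big_nil; apply: integral_ge0.
have -> : [set` x :: B] = [set x] `|` [set` B].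
  apply/seteqP; split => y /=; rewrite inE.
    by case/orP => [/eqP|]; [left|right].
  by case=> [->|->]; rewrite ?eqxx ?orbT.
rewrite big_cons ge0_integral_setU//; last first.
  apply/disj_setPRL => y /= yB yx; move: xB; rewrite -yx.
  by apply/negP; rewrite negbK.
apply: leeD; last exact: IH.
rewrite (@eq_integral _ _ _ _ _ (cst (f x))).
  by rewrite integral_cst// muleC.
by move=> y; rewrite inE => ->.
Qed.

(** Differentiate at [t = 0] the inequality [\sum_(x <- B) pi x * P t x y <= pi y], which is
    stationarity restricted to [B]. Finiteness of [B] lets the limit pass through the sum, at the
    price of equality; [y \in B] makes [pi y] a term of the sum. *)
Lemma stationary_subinvariant (Q : S -> S -> R) (P : R -> R.-pker S ~> S)
    (pi : probability S R) (B : seq S) (y : S) :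
  ctmc_semigroup Q P -> stationary_distribution P pi -> uniq B -> y \in B ->
  \sum_(x <- B) fine (pi [set x]) * Q x y <= 0.
Proof.
move=> [_ _ rates] stat uB yB.
pose g t := \sum_(x <- B) fine (pi [set x]) *
   ((fine (P t x [set y]) - (x == y)%:R) / t).
have gcvg : g t @[t --> 0^'+] --> \sum_(x <- B) fine (pi [set x]) * Q x y.
  rewrite /g; elim: (B) => [|x s IH].
    by under eq_fun do rewrite big_nil; rewrite big_nil; apply: cvg_cst.
  under eq_fun do rewrite big_cons.
  rewrite big_cons; apply: cvgD => //; apply: cvgM; first exact: cvg_cst.
  exact: rates.
apply: (ler_cvg_to gcvg (cvg_cst 0)).
near=> t.
have t0 : 0 < t by near: t; exact: nbhs_right_gt.
rewrite /g.
under eq_bigr do rewrite mulrA mulrBr.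
rewrite -mulr_suml pmulr_lle0 ?invr_gt0// sumrB subr_le0.
have -> : \sum_(x <- B) fine (pi [set x]) * (x == y)%:R = fine (pi [set y]).
  rewrite (bigD1_seq y)//= eqxx mulr1 big1 ?addr0// => x xy.
  by rewrite (negbTE xy) mulr0.
have fin (A : set S) : (pi A \is a fin_num).
  by apply: fin_num_measure; exact: discreteS.
have finP x : (P t x [set y] \is a fin_num).
  rewrite ge0_fin_numE//; apply: (@le_lt_trans _ _ (P t x setT)).
    by apply: le_measure; rewrite ?inE//; exact: discreteS.
  by rewrite prob_kernel ltry.
rewrite -lee_fin fineK// -sumEFin -(stat t _ (ltW t0) (discreteS [set y])).
under eq_bigr do rewrite EFinM !fineK//.
by apply: ge0_sum_le_integral.
Unshelve. all: by end_near.
Qed.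
End ContinuousTimeChains.

(** * Drift of test functions and tail bounds under a stationary law *)

Section Drift.
Context (R : realType) (I : nat) (Kbar : {fset config I}).
Context (lambda mu : 'I_I -> R) (p r : R).
Hypotheses (lambda_gt0 : forall i, 0 < lambda i) (mu_gt0 : forall i, 0 < mu i).
Hypothesis r_gt0 : 0 < r.
Implicit Types (x y : state Kbar) (f g : state Kbar -> R).

Local Notation T := (transition_sum lambda mu p r).

(** The generator applied to [f], as a finite sum over events rather than over the countable state
    space, so that no summability question arises. *)
Definition drift f x : R := T (fun y => f y - f x) x.

Lemma placement_prob_ge0 x i (k : config I) : 0 <= placement_prob p x i k.
Proof.
rewrite /placement_prob; case: ifP => _; first exact: ler0n.
by rewrite divr_ge0.
Qed.

Lemma le_transition_sum f g x : (forall y, f y <= g y) -> T f x <= T g x.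
Proof.
move=> fg; rewrite /transition_sum; apply: lerD;
  apply: ler_sum => i _; apply: ler_sum => k _; apply: ler_wpM2l => //.
- by rewrite mulr_ge0 ?placement_prob_ge0// mulr_ge0// ltW.
- by rewrite !mulr_ge0// ltW.
Qed.

Lemma transition_sumD f g x : T (fun y => f y + g y) x = T f x + T g x.
Proof.
rewrite /transition_sum addrACA; congr (_ + _); rewrite -big_split/=;
  by apply: eq_bigr => i _; rewrite -big_split/=; apply: eq_bigr => k _;
    rewrite mulrDr.
Qed.

Lemma transition_sumZ c f x : T (fun y => c * f y) x = c * T f x.
Proof.
rewrite /transition_sum mulrDr !mulr_sumr; congr (_ + _);
  by apply: eq_bigr => i _; rewrite mulr_sumr; apply: eq_bigr => k _;
    rewrite mulrCA.
Qed.

Lemma driftE f x : drift f x = T f x - f x * T (fun=> 1) x.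
Proof.
rewrite /drift transition_sumD; congr (_ + _).
have -> : (fun=> - f x) = (fun=> (- f x) * 1) :> (state Kbar -> R).
  by apply/funext => y; rewrite mulr1.
by rewrite (transition_sumZ _ (fun=> 1)) mulNr.
Qed.

Lemma driftD f g x : drift (fun y => f y + g y) x = drift f x + drift g x.
Proof. by rewrite !driftE transition_sumD; ring. Qed.

Lemma driftZ c f x : drift (fun y => c * f y) x = c * drift f x.
Proof. by rewrite !driftE transition_sumZ; ring. Qed.

Lemma transition_sum_sum (B : seq (state Kbar)) (c : state Kbar -> R)
    (g : state Kbar -> state Kbar -> R) x :
  T (fun y => \sum_(z <- B) c z * g z y) x = \sum_(z <- B) c z * T (g z) x.
Proof.
elim: B => [|z B IH].
  rewrite big_nil /transition_sum.
  by rewrite !big1 ?addr0// => i _; rewrite big1// => k _; rewrite big_nil mulr0.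
rewrite big_cons -IH -transition_sumZ -transition_sumD.
by congr (T _ x); apply/funext => y; rewrite big_cons.
Qed.

Variables (P : R -> R.-pker (state Kbar) ~> (state Kbar)).
Variable pi : probability (state Kbar) R.
Hypothesis hP : ctmc_semigroup (grand_generator lambda mu p r) P.
Hypothesis hpi : stationary_distribution P pi.

(* Subinvariance of [pi] is tested against the nonnegative finitely supported
   function [max (N - f) 0]. *)
Lemma stationary_drift_ge0 f (N : R) (B : seq (state Kbar)) :
  uniq B -> (forall x, (x \in B) = (f x < N)) ->
  0 <= \sum_(x <- B) fine (pi [set x]) * drift f x.
Proof.
move=> uB BE.
have sub y : y \in B ->
    \sum_(x <- B) fine (pi [set x]) * grand_generator lambda mu p r x y <= 0.
  by move=> yB; apply: (stationary_subinvariant _ hP hpi uB yB).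
have key : \sum_(y <- B) (N - f y) *
    (\sum_(x <- B) fine (pi [set x]) * grand_generator lambda mu p r x y) <= 0.
  rewrite big_seq; apply: sumr_le0 => y yB; rewrite mulr_ge0_le0 ?sub//.
  by rewrite subr_ge0 ltW// -BE.
rewrite -oppr_le0 -sumrN; apply: le_trans key.
under [leRHS]eq_bigr do rewrite mulr_sumr.
rewrite exchange_big/= big_seq [leRHS]big_seq.
apply: ler_sum => x xB.
rewrite -mulrN; under eq_bigr do rewrite mulrCA.
rewrite -mulr_sumr; apply: ler_wpM2l; first by rewrite fine_ge0.
rewrite /grand_generator.
under eq_bigr do rewrite mulrBr.
rewrite sumrB -(transition_sum_sum _ _ (fun y z => (z == y)%:R)).
have -> : \sum_(y <- B) (N - f y) * ((x == y)%:R * T (fun=> 1) x) =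
   (N - f x) * T (fun=> 1) x.
  rewrite (bigD1_seq x)//= eqxx mul1r big1 ?addr0// => y yx.
  by rewrite eq_sym (negbTE yx) mul0r mulr0.
have -> : - drift f x = T (fun y => N - f y) x - (N - f x) * T (fun=> 1) x.
  rewrite -driftE /drift -mulN1r -transition_sumZ.
  by congr (T _ x); apply/funext => y; ring.
(* The truncation equals [N - f] on [B]; off [B] it is 0 while [N - f <= 0]. Nonnegative rates
   preserve this comparison. *)
rewrite lerD2r; apply: le_transition_sum => y.
have [yB|yB] := boolP (y \in B).
  rewrite (bigD1_seq y)//= eqxx mulr1 big1 ?addr0// => z zy.
  by rewrite eq_sym (negbTE zy) mulr0.
rewrite big_seq big1; first by rewrite subr_le0 leNgt -BE.
move=> z zB; case: eqP => [yz|]; last by rewrite mulr0.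
by move: yB; rewrite yz zB.
Qed.

(** On the finite level set [f < N] the drift bound gives [m * pi (bad and f < N) <= c], and these
    events increase to [bad] with [N]. The limit is taken in the event and not in [f], so
    integrability of [f] does not enter. *)
Lemma stationary_tail f (bad : pred (state Kbar)) (c m : R) :
  (forall N, exists B, uniq B /\ forall x, (x \in B) = (f x < N)) ->
  0 <= c -> 0 < m -> (forall x, drift f x <= c - m * (bad x)%:R) ->
  (pi [set x | bad x] <= (c / m)%:E)%E.
Proof.
move=> coer c0 m0 fle.
pose F (n : nat) := [set x | bad x /\ f x < n%:R].
have FE : [set x | bad x] = \bigcup_n F n.
  apply/seteqP; split=> x /=; last by case=> n _ [].
  move=> bx; have [n Hn] : exists n, f x < n%:R.
    exists (Num.truncn `|f x|).+1.
    by rewrite (le_lt_trans (ler_norm _))// truncnS_gt.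
  by exists n.
have : (pi \o F) n @[n --> \oo] --> pi (\bigcup_n F n).
  apply: nondecreasing_cvg_mu => //.
  move=> n k nk; apply/subsetPset => x [bx fx]; split => //.
  by rewrite (lt_le_trans fx)// ler_nat.
rewrite FE => /cvge_to_le; apply.
near=> n => /=.
have [B [uB BE]] := coer n%:R.
have fin (A : set (state Kbar)) : (pi A \is a fin_num).
  by apply: fin_num_measure.
have FB : F n = [set` [seq x <- B | bad x]].
  by apply/seteqP; split => x /=; rewrite mem_filter BE => /andP.
have -> : pi (F n) = (\sum_(x <- B) fine (pi [set x]) * (bad x)%:R)%:E.
  rewrite FB -sumEFin.
  have : uniq [seq x <- B | bad x] by rewrite filter_uniq.
  rewrite (eq_bigr (fun x => if bad x then pi [set x] else 0%E)); last first.
    move=> x _; case: (bad x); rewrite ?mulr1 ?mulr0 ?fineK//.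
  rewrite -big_mkcond -big_filter.
  elim: {FB}[seq x <- B | bad x] => [|x s IH] /=.
    by rewrite set_nil measure0 big_nil.
  case/andP => xs us.
  rewrite big_cons -IH//.
  have -> : [set` x :: s] = [set x] `|` [set` s].
    apply/seteqP; split => y /=; rewrite inE.
      by case/orP => [/eqP|]; [left|right].
    by case=> [->|->]; rewrite ?eqxx ?orbT.
  rewrite measureU//; apply/seteqP; split => y //= [->].
  by rewrite (negbTE xs).
rewrite lee_fin ler_pdivlMr// mulr_suml.
have h := stationary_drift_ge0 uB BE.
have : 0 <= \sum_(x <- B) fine (pi [set x]) * (c - m * (bad x)%:R).
  apply: (le_trans h); apply: ler_sum => x _.
  by apply: ler_wpM2l; rewrite ?fine_ge0.
have -> : \sum_(x <- B) fine (pi [set x]) * (c - m * (bad x)%:R) =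
  (\sum_(x <- B) fine (pi [set x])) * c -
  \sum_(x <- B) fine (pi [set x]) * (bad x)%:R * m.
  by rewrite mulr_suml -sumrB; apply: eq_bigr => x _; ring.
rewrite subr_ge0 => /le_trans; apply.
rewrite ler_piMl// -lee_fin -sumEFin.
under eq_bigr do rewrite fineK//.
have dS (A : set (state Kbar)) : measurable A by [].
have := ge0_sum_le_integral dS pi (fun=> lee01) uB.
rewrite (eq_bigr (fun x => pi [set x])) => [|x _]; last exact: mule1.
by move=> /le_trans; apply; rewrite integral_cst// mul1e; apply: probability_le1.
Unshelve. all: by end_near.
Qed.
End Drift.

(** * Transitions of the packing chain *)

Section States.
Context (R : realType) (I : nat) (Kbar : {fset config I}).
Hypothesis hK : feasible_configs Kbar.
Local Notation K := (nonzero_configs Kbar).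
Implicit Types (x : state Kbar) (a b : config I) (i : 'I_I).

(** Extends [x] by 0 to all configurations, so that flows can be indexed by plain pairs
    [(a, cfg_add a i)]. At the zero configuration it is 0, not the number of zero-servers. *)
Definition count_servers x a : nat := if insub a is Some k then x k else 0%N.

Definition customers x i : nat := (\sum_(k : K) val k i * x k)%N.

Lemma in_nonzero_configs a : (a \in K) = (a != cfg0 I) && (a \in Kbar).
Proof. by rewrite !inE. Qed.

Lemma count_servers_val x (k : K) : count_servers x (val k) = x k.
Proof. by rewrite /count_servers valK. Qed.

Lemma count_servers_notin x a : a \notin K -> count_servers x a = 0%N.
Proof. by move=> aK; rewrite /count_servers insubN. Qed.

Lemma cfg_add_neq0 a i : cfg_add a i != cfg0 I.
Proof.
by apply/eqP => /(congr1 (fun f : config I => f i)); rewrite !ffunE eqxx addn1.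
Qed.

Lemma cfg_add_neq a i : cfg_add a i != a.
Proof.
apply/eqP => /(congr1 (fun f : config I => f i)).
by rewrite !ffunE eqxx addn1 => /esym/n_Sn.
Qed.

Lemma cfg_addK a i : cfg_sub (cfg_add a i) i = a.
Proof. by apply/ffunP => j; rewrite !ffunE addnK. Qed.

Lemma cfg_subK a i : (0 < a i)%N -> cfg_add (cfg_sub a i) i = a.
Proof.
move=> ai; apply/ffunP => j; rewrite !ffunE; case: eqP => [->|_].
  by rewrite subnK.
by rewrite subn0 addn0.
Qed.

Lemma cfg_addE a i j : cfg_add a i j = (a j + (j == i))%N.
Proof. by rewrite ffunE. Qed.

Lemma cfg_add_in a i : (cfg_add a i \in K) = (cfg_add a i \in Kbar).
Proof. by rewrite in_nonzero_configs cfg_add_neq0. Qed.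

Lemma cfg_sub_in a i : a \in Kbar -> cfg_sub a i \in Kbar.
Proof. by move=> aK; apply: hK.1 aK _ => j; rewrite ffunE leq_subr. Qed.

Lemma cfg0_in (i : 'I_I) : cfg0 I \in Kbar.
Proof. by apply: hK.1 (hK.2 i) _ => j; rewrite ffunE. Qed.

Lemma sum_val_eq (b : config I) (c : R) :
  \sum_(k : K) (if val k == b then c else 0) = (b \in K)%:R * c.
Proof.
have [bK|bK] := boolP (b \in K); last first.
  rewrite mul0r big1// => k _; case: eqP => // kb.
  by move: bK; rewrite -kb (valP k).
rewrite mul1r (bigD1 [` bK]%fset)//= eqxx big1 ?addr0// => k.
by rewrite -val_eqE/= => /negbTE ->.
Qed.

(** A functional that is a sum over configurations changes only in the coordinates [a] and [b]; the
    membership factors discard the zero configuration. Serves both the entropy and the customer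
    counts. *)
Lemma sum_move_server (phi : config I -> nat -> R) x a b :
  a != b -> (a \in K -> (0 < count_servers x a)%N) ->
  \sum_(k : K) phi (val k) (move_server x a b k)
    - \sum_(k : K) phi (val k) (x k) =
  (b \in K)%:R * (phi b (count_servers x b).+1 - phi b (count_servers x b)) +
  (a \in K)%:R * (phi a (count_servers x a).-1 - phi a (count_servers x a)).
Proof.
move=> ab posa; rewrite -!sum_val_eq -sumrB -big_split/=.
apply: eq_bigr => k _; rewrite ffunE.
have [ka|ka] := eqVneq (val k) a.
  by rewrite -ka in ab *; rewrite (negbTE ab) count_servers_val add0r addn0 subn1.
have [kb|kb] := eqVneq (val k) b.
  by rewrite -kb count_servers_val addr0 subn0 addn1.
by rewrite subn0 addn0 subrr addr0.
Qed.

(** Reindexes departures by the configuration they lead to, so that each one is paired with the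
    opposite arrival. *)
Lemma sum_departures i (F : config I -> R) :
  \sum_(k : K | (0 < val k i)%N) F (val k) =
  \sum_(k : Kbar | cfg_add (val k) i \in Kbar) F (cfg_add (val k) i).
Proof.
have -> : \sum_(k : Kbar | cfg_add (val k) i \in Kbar) F (cfg_add (val k) i) =
    \sum_(k <- Kbar | cfg_add k i \in Kbar) F (cfg_add k i).
  by rewrite (big_seq_fsetE _ _ (fun k => cfg_add k i \in Kbar) (fun k => F (cfg_add k i))).
have -> : \sum_(k : K | (0 < val k i)%N) F (val k) =
    \sum_(k <- K | (0 < k i)%N) F k.
  by rewrite (big_seq_fsetE _ _ (fun k : config I => (0 < k i)%N) F).
rewrite -big_filter -[RHS]big_filter.
rewrite -[RHS](big_map (fun k => cfg_add k i) xpredT F).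
apply: perm_big; apply: uniq_perm.
- exact/filter_uniq/fset_uniq.
- rewrite map_inj_uniq; first exact/filter_uniq/fset_uniq.
  by apply: (can_inj (g := fun a => cfg_sub a i)) => a; exact: cfg_addK.
move=> a; rewrite mem_filter; apply/andP/mapP.
  move=> [ai aK]; exists (cfg_sub a i); last by rewrite cfg_subK.
  move: aK; rewrite in_nonzero_configs mem_filter cfg_subK// => /andP[_ aK].
  by rewrite aK cfg_sub_in.
move=> [b]; rewrite mem_filter => /andP[biK bK] ->.
by rewrite cfg_add_in biK cfg_addE eqxx addn1.
Qed.

Lemma sum_customers x : total_customers x = (\sum_(i < I) customers x i)%N.
Proof. by []. Qed.

Lemma customers_departures x i :
  \sum_(k : Kbar | cfg_add (val k) i \in Kbar)
     (cfg_add (val k) i i)%:R * (count_servers x (cfg_add (val k) i))%:R =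
  (customers x i)%:R :> R.
Proof.
rewrite -(sum_departures i (fun a => (a i)%:R * (count_servers x a)%:R)).
rewrite /customers natr_sum [RHS](bigID (fun k : K => (0 < val k i)%N))/=.
rewrite [X in _ = _ + X]big1 ?addr0; last first.
  by move=> k; rewrite lt0n negbK => /eqP ->; rewrite mul0n.
by apply: eq_bigr => k _; rewrite count_servers_val natrM.
Qed.

Lemma nonzero_config_pos (k : K) : exists i, (0 < val k i)%N.
Proof.
have := valP k; rewrite in_nonzero_configs => /andP[k0 _].
apply: contrapT => h; move/eqP: k0; apply; apply/ffunP => i; rewrite ffunE.
by apply/eqP; rewrite -leqn0 leqNgt; apply/negP => ki; apply: h; exists i.
Qed.

Lemma sum_count_le x : (\sum_(k : K) x k <= total_customers x)%N.
Proof.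
rewrite /total_customers exchange_big/=; apply: leq_sum => k _.
have [i ki] := nonzero_config_pos k.
rewrite (bigD1 i)//=; apply: leq_trans (leq_addr _ _).
by rewrite leq_pmull.
Qed.

Lemma count_servers_le x a : (count_servers x a <= total_customers x)%N.
Proof.
have [aK|aK] := boolP (a \in K); last by rewrite count_servers_notin.
rewrite -[a]/(val [` aK]%fset) count_servers_val.
by apply: leq_trans (sum_count_le x); rewrite (bigD1 [` aK]%fset)//= leq_addr.
Qed.

Lemma customers_move_server x a b j : a != b ->
  (a \in K -> (0 < count_servers x a)%N) ->
  (customers (move_server x a b) j)%:R - (customers x j)%:R =
  (b \in K)%:R * (b j)%:R - (a \in K)%:R * (a j)%:R :> R.
Proof.
move=> ab ha.
have := sum_move_server (fun k n => (k j * n)%:R) ab ha.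
rewrite /customers !natr_sum => ->.
congr (_ + _); first by rewrite -natrB ?leq_mul2l ?leqnSn ?orbT// -mulnBr subSn// subnn muln1.
have [aK|] := boolP (a \in K); last by rewrite !mul0r oppr0.
by rewrite !mul1r -{2}(prednK (ha aK)) mulnS natrD opprD addrCA subrr addr0.
Qed.

Lemma sum_all_configs i (Pd : pred (config I)) (F : config I -> R) :
  \sum_(k : Kbar | Pd (val k)) F (val k) =
  (if Pd (cfg0 I) then F (cfg0 I) else 0) + \sum_(k : K | Pd (val k)) F (val k).
Proof.
rewrite -(big_seq_fsetE _ _ Pd F) -(big_seq_fsetE _ _ Pd F)/=.
rewrite (perm_big (cfg0 I :: K)) ?big_cons/=.
  by case: ifP; rewrite ?add0r.
apply: uniq_perm; rewrite /= ?fset_uniq ?andbT//.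
  by rewrite in_nonzero_configs eqxx.
move=> a; rewrite in_cons in_nonzero_configs.
by case: eqP => //= ->; rewrite (cfg0_in i).
Qed.

Variable p : R.
Local Notation X0 := (zero_servers p).

Lemma sum_placement_prob x i :
  \sum_(k : Kbar | cfg_add (val k) i \in Kbar) placement_prob p x i (val k) = 1.
Proof.
rewrite /placement_prob; have [A0|A0] := eqVneq (available p x i) 0%N.
  rewrite (bigD1 [` cfg0_in i]%fset)/=; last exact: (hK.2 i).
  rewrite eqxx big1 ?addr0// => k /andP[_]; rewrite -val_eqE/=.
  by move=> /negbTE ->.
rewrite -mulr_suml.
suff -> : \sum_(k : Kbar | cfg_add (val k) i \in Kbar) (servers p x (val k))%:R =
  (available p x i)%:R :> R by rewrite divff// pnatr_eq0.
rewrite (sum_all_configs i (fun k => cfg_add k i \in Kbar)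
  (fun k => (servers p x k)%:R)) (hK.2 i) /available natrD.
congr (_ + _); first by rewrite /servers eqxx.
rewrite natr_sum; apply: eq_big => k; first by rewrite cfg_add_in.
have := valP k; rewrite in_nonzero_configs => /andP[k0 _] _.
by rewrite /servers (negbTE k0) valK.
Qed.
End States.

(** * Drift of the entropy and of the customer imbalance *)

Section Lyapunov.
Context (R : realType) (I : nat) (Kbar : {fset config I}).
Hypothesis hK : feasible_configs Kbar.
Context (lambda mu : 'I_I -> R) (p r : R).
Hypotheses (lambda_gt0 : forall i, 0 < lambda i) (mu_gt0 : forall i, 0 < mu i).
Hypothesis r_gt0 : 0 < r.
Local Notation K := (nonzero_configs Kbar).
Local Notation Y := customers.
Local Notation drift := (drift lambda mu p r).
Implicit Types (x : state Kbar) (a b : config I) (i : 'I_I).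

Definition arrival_rate x i a : R := lambda i * r * placement_prob p x i a.

(** Indexed by the configuration after the departure: the rate of the move opposite to the one of
    [arrival_rate x i a]. *)
Definition departure_rate x i a : R :=
  mu i * (cfg_add a i i)%:R * (count_servers x (cfg_add a i))%:R.

Lemma driftE_pairs (f : state Kbar -> R) x :
  drift f x = \sum_(i < I) \sum_(k : Kbar | cfg_add (val k) i \in Kbar)
    (arrival_rate x i (val k) *
       (f (move_server x (val k) (cfg_add (val k) i)) - f x) +
     departure_rate x i (val k) *
       (f (move_server x (cfg_add (val k) i) (val k)) - f x)).
Proof.
rewrite /drift /transition_sum -big_split/=; apply: eq_bigr => i _.
rewrite big_split/=; congr (_ + _).
under eq_bigr => k _ do rewrite -count_servers_val.
rewrite (sum_departures hK i (fun a => mu i * (a i)%:R * (count_servers x a)%:R *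
   (f (move_server x a (cfg_sub a i)) - f x))).
by apply: eq_bigr => k _; rewrite cfg_addK.
Qed.

Lemma arrival_rate_ge0 x i a : 0 <= arrival_rate x i a.
Proof. by rewrite /arrival_rate mulr_ge0 ?placement_prob_ge0// mulr_ge0// ltW. Qed.

Lemma departure_rate_ge0 x i a : 0 <= departure_rate x i a.
Proof. by rewrite /departure_rate mulr_ge0// mulr_ge0// ltW. Qed.

Lemma sum_arrival_rate x i :
  \sum_(k : Kbar | cfg_add (val k) i \in Kbar) arrival_rate x i (val k) =
  lambda i * r.
Proof. by rewrite -mulr_sumr sum_placement_prob// mulr1. Qed.

Lemma sum_departure_rate x i :
  \sum_(k : Kbar | cfg_add (val k) i \in Kbar) departure_rate x i (val k) =
  mu i * (Y x i)%:R.
Proof.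
rewrite -(customers_departures R hK x i) mulr_sumr.
by apply: eq_bigr => k _; rewrite mulrA.
Qed.

Lemma servers_nonzero x a : a != cfg0 I -> servers p x a = count_servers x a.
Proof. by rewrite /servers => /negbTE ->. Qed.

Lemma arrival_rate_neq0 x i a : a \in K -> arrival_rate x i a != 0 ->
  (0 < count_servers x a)%N.
Proof.
rewrite in_nonzero_configs => /andP[a0 _] h; rewrite lt0n; apply: contra h.
move=> /eqP c0; rewrite /arrival_rate /placement_prob (negbTE a0).
by rewrite servers_nonzero// c0 mul0r if_same mulr0.
Qed.

Lemma not_in_nonzero_configs a : a \in Kbar -> a \notin K -> a = cfg0 I.
Proof. by move=> aK; rewrite in_nonzero_configs aK andbT negbK => /eqP. Qed.

Definition cfg_fact a : nat := \prod_(i < I) (a i)`!.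

Lemma cfg_fact_gt0 a : (0 < cfg_fact a)%N.
Proof. by rewrite prodn_gt0// => i; rewrite fact_gt0. Qed.

Lemma cfg_fact_add a i : cfg_fact (cfg_add a i) = (cfg_add a i i * cfg_fact a)%N.
Proof.
rewrite /cfg_fact (bigD1 i)//= [in RHS](bigD1 i)//= mulnA cfg_addE eqxx addn1.
rewrite factS; congr (_ * _)%N; apply: eq_bigr => j ji.
by rewrite cfg_addE (negbTE ji) addn0.
Qed.

(** The factorials account for the factor [k_i] in departure rates. The constant [p * ln r] stands
    in for the logarithm of the number of zero-servers, which varies with the state and would add to
    the drift. *)
Definition log_weight a : R := ln (cfg_fact a)%:R - p * ln r.

Definition entropy x : R :=
  \sum_(k : K) (ln ((x k)`!)%:R + (x k)%:R * log_weight (val k)).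

(** The increment of [entropy] when a server in configuration [a] is added; 0 at the zero
    configuration, which is not a coordinate of the state. *)
Definition potential x a : R :=
  if a == cfg0 I then 0 else ln (count_servers x a).+1%:R + log_weight a.

Let phi a n : R := ln (n`!)%:R + n%:R * log_weight a.

Lemma phiS a n : phi a n.+1 - phi a n = ln n.+1%:R + log_weight a.
Proof.
rewrite /phi factS natrM lnM ?posrE ?ltr0n ?fact_gt0//.
rewrite -[n.+1%:R * log_weight a]/((n.+1)%:R * _) -natr1; ring.
Qed.

Lemma ln_succ_le n : ln n.+2%:R - ln n.+1%:R <= n.+1%:R^-1 :> R.
Proof.
rewrite -ln_div ?posrE//.
have -> : n.+2%:R / n.+1%:R = 1 + n.+1%:R^-1 :> R.
  by rewrite -[n.+2%:R]natr1 mulrDl divff// mul1r.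
by apply: le_ln1Dx; rewrite (lt_le_trans (y := 0))// ltrN10.
Qed.

(** The server leaving [a] lowers the entropy by a term in [ln X_a], where [potential] has
    [ln (X_a + 1)]. The discrepancy is at most [1 / X_a], and [X_a] cancels against the placement
    probability [X_a / X_(i)]. *)
Lemma entropy_arrival x i a : a \in Kbar -> cfg_add a i \in Kbar ->
  arrival_rate x i a *
    (entropy (move_server x a (cfg_add a i)) - entropy x) <=
  arrival_rate x i a * (potential x (cfg_add a i) - potential x a)
  + lambda i * r / (available p x i)%:R.
Proof.
move=> aK bK.
have rem_ge0 : 0 <= lambda i * r / (available p x i)%:R.
  by rewrite !mulr_ge0 ?invr_ge0// ltW.
have [b0|b0] := eqVneq (arrival_rate x i a) 0; first by rewrite b0 !mul0r add0r.
have := @arrival_rate_neq0 x i a; move=> /(_ _ b0) ca.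
have ab : a != cfg_add a i by rewrite eq_sym cfg_add_neq.
rewrite /entropy (sum_move_server phi ab ca).
have bK' : cfg_add a i \in K by rewrite cfg_add_in.
rewrite bK' mul1r phiS {1}/potential (negbTE (cfg_add_neq0 _ _)).
have [aK'|aK'] := boolP (a \in K); last first.
  have /eqP a0 := not_in_nonzero_configs aK aK'.
  by rewrite mul0r addr0 [potential x a]/potential a0 subr0 lerDl.
rewrite mul1r -(prednK (ca aK')) -opprB phiS.
set c := (count_servers x a).-1.
have a0 : a != cfg0 I by move: aK'; rewrite in_nonzero_configs => /andP[].
have cE : count_servers x a = c.+1 by rewrite prednK// ca.
rewrite /potential (negbTE a0) cE.
have h : arrival_rate x i a * (ln c.+2%:R - ln c.+1%:R) <=
   lambda i * r / (available p x i)%:R.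
  apply: (@le_trans _ _ (arrival_rate x i a * c.+1%:R^-1)).
    by rewrite ler_wpM2l ?arrival_rate_ge0// ln_succ_le.
  rewrite /arrival_rate /placement_prob (negbTE a0) servers_nonzero// cE.
  case: eqP => [->|A0]; first by rewrite mulr0 mul0r invr0 mulr0.
  by rewrite -mulrA [_ / _ / _]mulrAC divff ?pnatr_eq0// mul1r.
rewrite -lerBlDl -mulrBr; apply: le_trans h.
by apply: ler_wpM2l; [exact: arrival_rate_ge0 | lra].
Qed.

(** The same shift by one, now at [cfg_add a i]; its server count cancels against the departure
    rate, which is proportional to it. *)
Lemma entropy_departure x i a : a \in Kbar -> cfg_add a i \in Kbar ->
  departure_rate x i a *
    (entropy (move_server x (cfg_add a i) a) - entropy x) <=
  - departure_rate x i a * (potential x (cfg_add a i) - potential x a)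
  + mu i * (cfg_add a i i)%:R.
Proof.
move=> aK bK.
have rem_ge0 : 0 <= mu i * (cfg_add a i i)%:R by rewrite mulr_ge0// ltW.
have [b0|b0] := eqVneq (count_servers x (cfg_add a i)) 0%N.
  by rewrite /departure_rate b0 mulr0 oppr0 !mul0r add0r.
have cb : cfg_add a i \in K -> (0 < count_servers x (cfg_add a i))%N.
  by rewrite lt0n.
rewrite /entropy (sum_move_server phi (cfg_add_neq a i) cb).
have bK' : cfg_add a i \in K by rewrite cfg_add_in.
rewrite bK' mul1r phiS {1}/potential (negbTE (cfg_add_neq0 _ _)).
set c := (count_servers x (cfg_add a i)).-1.
have cE : count_servers x (cfg_add a i) = c.+1 by rewrite prednK// cb.
rewrite cE -(opprB (phi _ c.+1)) phiS.
have -> : (a \in K)%:R * (ln (count_servers x a).+1%:R + log_weight a) =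
   potential x a.
  rewrite /potential; have [aK'|aK'] := boolP (a \in K).
    by move: aK'; rewrite in_nonzero_configs mul1r => /andP[/negbTE -> _].
  by rewrite (not_in_nonzero_configs aK aK') eqxx mul0r.
have h : departure_rate x i a * (ln c.+2%:R - ln c.+1%:R) <=
   mu i * (cfg_add a i i)%:R.
  apply: (@le_trans _ _ (departure_rate x i a * c.+1%:R^-1)).
    by rewrite ler_wpM2l ?departure_rate_ge0// ln_succ_le.
  by rewrite /departure_rate cE -mulrA mulfV// mulr1.
rewrite mulNr [leRHS]addrC lerBrDr; apply: le_trans h.
rewrite -mulrDr; apply: ler_wpM2l; first exact: departure_rate_ge0.
lra.
Qed.

Lemma drift_entropy_le x :
  drift entropy x <=
  \sum_(i < I) \sum_(k : Kbar | cfg_add (val k) i \in Kbar)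
   ((arrival_rate x i (val k) - departure_rate x i (val k)) *
      (potential x (cfg_add (val k) i) - potential x (val k))
    + lambda i * r / (available p x i)%:R
    + mu i * (cfg_add (val k) i i)%:R).
Proof.
rewrite driftE_pairs; apply: ler_sum => i _; apply: ler_sum => k hk.
apply: le_trans (lerD (entropy_arrival x (valP k) hk)
  (entropy_departure x (valP k) hk)) _.
lra.
Qed.

Definition imbalance x i : R := (Y x i)%:R - lambda i / mu i * r.

(** Dividing by [mu i] gives every type the same contraction rate 2 in [drift_imbalance_energy]. *)
Definition imbalance_energy x : R := \sum_(i < I) imbalance x i ^+ 2 / mu i.

Lemma customers_arrival x i j a : a \in Kbar -> cfg_add a i \in Kbar ->
  arrival_rate x i a != 0 ->
  (Y (move_server x a (cfg_add a i)) j)%:R - (Y x j)%:R = (j == i)%:R :> R.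
Proof.
move=> aK bK h; rewrite customers_move_server; last 2 first.
- by rewrite eq_sym cfg_add_neq.
- by move=> /arrival_rate_neq0; apply; exact: h.
rewrite cfg_add_in bK mul1r cfg_addE natrD.
have [aK'|aK'] := boolP (a \in K); first by rewrite mul1r addrAC subrr add0r.
by rewrite mul0r subr0 (not_in_nonzero_configs aK aK') ffunE add0r.
Qed.

Lemma customers_departure x i j a : a \in Kbar -> cfg_add a i \in Kbar ->
  departure_rate x i a != 0 ->
  (Y (move_server x (cfg_add a i) a) j)%:R - (Y x j)%:R = - (j == i)%:R :> R.
Proof.
move=> aK bK h; rewrite customers_move_server ?cfg_add_neq//; last first.
  move=> _; rewrite lt0n; apply: contra h => /eqP h.
  by rewrite /departure_rate h mulr0.
rewrite cfg_add_in bK mul1r cfg_addE natrD.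
have [aK'|aK'] := boolP (a \in K); first by rewrite mul1r opprD addrA subrr add0r.
by rewrite mul0r (not_in_nonzero_configs aK aK') ffunE !add0r.
Qed.

Lemma imbalance_energy_step x y i (e : R) :
  (forall j, (Y y j)%:R - (Y x j)%:R = e * (j == i)%:R :> R) -> e ^+ 2 = 1 ->
  imbalance_energy y - imbalance_energy x =
  (2 * e * imbalance x i + 1) / mu i.
Proof.
move=> h e2; rewrite /imbalance_energy (bigD1 i)//= [X in _ - X](bigD1 i)//=.
have hj j : imbalance y j = imbalance x j + e * (j == i)%:R.
  by rewrite -h /imbalance; ring.
rewrite (eq_bigr (fun j => imbalance x j ^+ 2 / mu j)); last first.
  by move=> j ji; rewrite hj (negbTE ji) mulr0 addr0.
rewrite hj eqxx mulr1 sqrrD e2; ring.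
Qed.

(** Placement does not affect the customer counts, which evolve as independent infinite-server
    queues; hence an exact formula without reference to configurations. *)
Lemma drift_imbalance_energy x :
  drift imbalance_energy x =
  \sum_(i < I) (- 2 * imbalance x i ^+ 2 + lambda i / mu i * r + (Y x i)%:R).
Proof.
rewrite driftE_pairs; apply: eq_bigr => i _.
transitivity (\sum_(k : Kbar | cfg_add (val k) i \in Kbar)
   (arrival_rate x i (val k) * ((2 * imbalance x i + 1) / mu i) +
    departure_rate x i (val k) * ((- 2 * imbalance x i + 1) / mu i))).
  apply: eq_bigr => k hk; congr (_ + _).
    have [->|h] := eqVneq (arrival_rate x i (val k)) 0; first by rewrite !mul0r.
    rewrite (@imbalance_energy_step _ _ i 1) ?expr1n ?mulr1// => j.
    by rewrite customers_arrival// ?mul1r//; exact: valP.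
  have [->|h] := eqVneq (departure_rate x i (val k)) 0; first by rewrite !mul0r.
  rewrite (@imbalance_energy_step _ _ i (-1)) ?sqrrN ?expr1n ?mulrN1// => j.
  by rewrite customers_departure// ?mulN1r//; exact: valP.
rewrite big_split/= -!mulr_suml sum_arrival_rate sum_departure_rate.
have m0 : mu i != 0 by rewrite gt_eqF.
by rewrite /imbalance; field.
Qed.

End Lyapunov.

(** * Finiteness of the level sets of the Lyapunov function *)

Section Coercivity.
Context (R : realType) (I : nat) (Kbar : {fset config I}).
Context (lambda mu : 'I_I -> R) (p r : R).
Hypothesis mu_gt0 : forall i, 0 < mu i.
Local Notation K := (nonzero_configs Kbar).
Implicit Types x : state Kbar.

Definition lyapunov (w : R) x : R :=
  entropy p r x + w * imbalance_energy lambda mu r x.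

(** Since [ln (n!) >= 0], the entropy is bounded below by a multiple [- c] of the number of
    customers, and the quadratic term beats any linear one, here the slope [c + 1]. *)
Lemma lyapunov_ge (w : R) : 0 < w ->
  exists C : R, forall x, (total_customers x)%:R - C <= lyapunov w x.
Proof.
move=> w0; pose c : R := \sum_(k : K) `|log_weight p r (val k)|.
have c0 : 0 <= c by apply: sumr_ge0.
pose m i := lambda i / mu i * r.
exists (\sum_(i < I) ((c + 1) * m i + (c + 1) ^+ 2 * mu i / w)) => x.
have e1 : - c * (total_customers x)%:R <= entropy p r x.
  apply: (@le_trans _ _ (\sum_(k : K) - c * (x k)%:R)).
    rewrite -mulr_sumr -natr_sum !mulNr lerN2 ler_wpM2l// ler_nat.
    exact: sum_count_le.
  apply: ler_sum => k _; rewrite -[leLHS]add0r; apply: lerD.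
    by rewrite ln_ge0// ler1n fact_gt0.
  rewrite [leRHS]mulrC; apply: ler_wpM2r => //; rewrite lerNl.
  apply: (@le_trans _ _ `|log_weight p r (val k)|).
    by rewrite -normrN ler_norm.
  by rewrite /c (bigD1 k)//= lerDl sumr_ge0.
have e2 : (c + 1) * (total_customers x)%:R
    - \sum_(i < I) ((c + 1) * m i + (c + 1) ^+ 2 * mu i / w) <=
    w * imbalance_energy lambda mu r x.
  rewrite sum_customers natr_sum mulr_sumr -sumrB mulr_sumr.
  apply: ler_sum => i _; rewrite /imbalance -/(m i).
  set y : R := (customers x i)%:R - m i.
  have -> : (c + 1) * (customers x i)%:R = (c + 1) * (y + m i).
    by rewrite /y subrK.
  rewrite -subr_ge0.
  have mi := mu_gt0 i.
  (* Completing the square in [y]. *)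
  have -> : w * (y ^+ 2 / mu i) -
    ((c + 1) * (y + m i) - ((c + 1) * m i + (c + 1) ^+ 2 * mu i / w)) =
    (w / mu i) * ((y - (c + 1) * mu i / w / 2) ^+ 2 +
      3 / 4 * ((c + 1) * mu i / w) ^+ 2).
    by field; rewrite !gt_eqF.
  apply: mulr_ge0; first by rewrite divr_ge0// ltW.
  by apply: addr_ge0; [exact: sqr_ge0 | apply: mulr_ge0; [|exact: sqr_ge0]].
rewrite /lyapunov; lra.
Qed.

Lemma finitely_many_states (n : nat) :
  exists B : seq (state Kbar), forall x, (total_customers x <= n)%N -> x \in B.
Proof.
exists [seq [ffun k => nat_of_ord (g k)] | g : {ffun K -> 'I_n.+1}] => x xn.
apply/mapP; exists [ffun k => inord (x k)]; first by rewrite mem_enum.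
apply/ffunP => k; rewrite !ffunE inordK// ltnS.
by rewrite -count_servers_val (leq_trans (count_servers_le _ _)).
Qed.

Lemma lyapunov_coercive (w N : R) : 0 < w ->
  exists B, uniq B /\ forall x, (x \in B) = (lyapunov w x < N).
Proof.
move=> w0; have [C hC] := lyapunov_ge w0.
have [B hB] := finitely_many_states (Num.truncn `|N + C|).+1.
exists (undup [seq x <- B | lyapunov w x < N]); rewrite undup_uniq; split => // x.
rewrite mem_undup mem_filter andb_idr// => xN; apply: hB.
rewrite -(ler_nat R).
apply: le_trans (ltW (truncnS_gt _)); apply: le_trans (ler_norm _).
by rewrite -lerBlDr ltW// (le_lt_trans (hC x)).
Qed.
End Coercivity.

(** * Drift estimates *)

Section RealInequalities.
Context (R : realType).
Implicit Types a b c s t u : R.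

Lemma ln_le_self a : 0 < a -> ln a <= a.
Proof. by move=> a0; rewrite ltW// ln_sublinear. Qed.

Lemma ln_le_sub1 a : 0 < a -> ln a <= a - 1.
Proof.
move=> a0; have -> : a = 1 + (a - 1) by rewrite addrC subrK.
by rewrite [1 + _ in leRHS]addrC addrK; apply: le_ln1Dx; lra.
Qed.

Lemma gt0_dissipation_ge0 a b : 0 < a -> 0 < b -> 0 <= (a - b) * ln (a / b).
Proof.
move=> a0 b0; have [ab|/ltW ab] := leP b a.
  by rewrite mulr_ge0 ?subr_ge0// ln_ge0// ler_pdivlMr// mul1r.
by rewrite mulr_le0// ?subr_le0// ln_le0// ler_pdivrMr// mul1r.
Qed.

(** With [a = b * expR t] the hypothesis reads [(expR t - 1) * t <= 1 / 4], whereas the left side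
    exceeds [1 / 2] as soon as [|t| > 1]. *)
Lemma dissipation_small a b : 0 < a -> 0 < b ->
  (a - b) * ln (a / b) <= b / 4 -> `|ln (a / b)| <= 1.
Proof.
move=> a0 b0; set t := ln (a / b) => h.
have aE : a = b * expR t by rewrite /t lnK ?posrE ?divr_gt0// mulrCA mulfV ?mulr1// gt_eqF.
have {}h : (expR t - 1) * t <= 1 / 4.
  rewrite (_ : _ * t = (a - b) * t / b); last first.
    by rewrite aE; field; rewrite gt_eqF.
  rewrite ler_pdivrMr//; lra.
rewrite ler_norml leNgt [t <= 1]leNgt -negb_or; apply/negP => /orP[t1|t1].
  have e1 : expR t <= 1 / 2.
    have : 2 <= expR (- t) by apply: le_trans (expR_ge1Dx _); lra.
    rewrite expRN => h2; rewrite -[expR t]invrK.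
    by rewrite ler_pdivlMr// ler_pdivrMl ?invr_gt0 ?expR_gt0//; lra.
  nra.
have := expR_ge1Dx t; nra.
Qed.

(** Cauchy-Schwarz, obtained by applying [y <= (m / d) * y ^+ 2 / 2 + (d / m) / 2] to each term,
    with [d] the sum itself. *)
Lemma sum_abs_sq_le (n : nat) (f : 'I_n -> R) (m : R) : 0 < m -> n%:R <= m ->
  (\sum_(i < n) `|f i|) ^+ 2 <= m * \sum_(i < n) f i ^+ 2.
Proof.
move=> m0 nm; set d := \sum_(i < n) `|f i|.
have [->|d0] := eqVneq d 0.
  by rewrite expr0n/= mulr_ge0 ?sumr_ge0// ?ltW// => i _; rewrite sqr_ge0.
have {}d0 : 0 < d by rewrite lt0r d0 sumr_ge0.
have : d <= \sum_(i < n) (m / d * f i ^+ 2 / 2 + d / m / 2).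
  apply: ler_sum => i _.
  rewrite -real_normK ?num_real//; set y := `|f i|.
  have -> : m / d * y ^+ 2 / 2 + d / m / 2 =
     y + (m / d) / 2 * (y - d / m) ^+ 2 by field; rewrite !gt_eqF.
  rewrite lerDl; apply: mulr_ge0; last exact: sqr_ge0.
  by rewrite !divr_ge0// ltW.
rewrite big_split/= sumr_const card_ord -mulr_suml -mulr_sumr.
set D := \sum_(i < n) f i ^+ 2 => h.
have : (d / m / 2) *+ n <= d / 2.
  rewrite -mulr_natr (_ : _ * _ = d / m * n%:R / 2); last by ring.
  by rewrite ler_wpM2r// mulrAC ler_pdivrMr// ler_wpM2l// ltW.
have : m / d * D / 2 * d = m * D / 2 by field; rewrite gt_eqF.
nra.
Qed.

Lemma powR_scale (p s : R) : 7 / 8 < p -> p < 1 -> 1 <= s ->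
  s ^+ 7 <= (s ^+ 8) `^ p <= s ^+ 8.
Proof.
move=> p1 p2 s1; have s0 : 0 <= s by lra.
have e8 : 1 <= s ^+ 8 by rewrite exprn_ege1.
apply/andP; split; last by rewrite ler1_powR// ltW.
rewrite -!powR_mulrn// -powRrM ler_powR//.
lra.
Qed.

Lemma ln_scale s : 1 <= s -> ln (s ^+ 8) <= 8 * s.
Proof.
move=> s1; rewrite lnXn; last by lra.
have : ln s <= s by rewrite ln_le_self; lra.
by rewrite -[ln s *+ 8]mulr_natl; lra.
Qed.

End RealInequalities.

(** * Regularised occupancies and pairs of opposite flows *)

Section Occupancy.
Context (R : realType) (I : nat) (Kbar : {fset config I}).
Context (lambda mu : 'I_I -> R) (p r : R).
Implicit Types (x : state Kbar) (a : config I) (i : 'I_I).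

(** The shift by one off the zero configuration matches [potential] and keeps logarithms meaningful
    at empty coordinates. Its cost is bounded in [arrival_rate_upflow] and
    [departure_rate_downflow]. *)
Definition occupancy x a : R :=
  if a == cfg0 I then (zero_servers p x)%:R else (count_servers x a).+1%:R.

Definition upflow x i a : R :=
  lambda i * r * occupancy x a / (available p x i)%:R.

Definition downflow x i a : R :=
  mu i * (cfg_add a i i)%:R * occupancy x (cfg_add a i).

(* The symmetrised relative entropy of the pair of opposite flows between the
   configurations [a] and [cfg_add a i]. *)
Definition dissipation x i a : R :=
  (downflow x i a - upflow x i a) * ln (downflow x i a / upflow x i a).

Lemma zero_serversE x :
  (zero_servers p x)%:R = (Num.ceil ((total_customers x)%:R `^ p))%:~R :> R.
Proof.
rewrite /zero_servers natr_absz ger0_norm// ceil_ge0.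
by rewrite (lt_le_trans _ (powR_ge0 _ _))// ltrN10.
Qed.

Lemma zero_servers_ge x : (total_customers x)%:R `^ p <= (zero_servers p x)%:R.
Proof. by rewrite zero_serversE ceil_ge. Qed.

Lemma zero_servers_le x :
  (zero_servers p x)%:R <= (total_customers x)%:R `^ p + 1.
Proof.
rewrite zero_serversE -lerBlDr ltW//.
by have := ceilB1_lt ((total_customers x)%:R `^ p); rewrite intrD.
Qed.

Lemma sum_count_available x i :
  ((available p x i)%:R : R) <= (zero_servers p x)%:R + (total_customers x)%:R.
Proof.
rewrite -natrD ler_nat leq_add2l; apply: leq_trans (sum_count_le x).
by rewrite [leqRHS](bigID (fun k : nonzero_configs Kbar =>
  cfg_add (val k) i \in nonzero_configs Kbar)) leq_addr.
Qed.

Lemma zero_servers_available x i : (zero_servers p x <= available p x i)%N.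
Proof. exact: leq_addr. Qed.

End Occupancy.

(** * Quantitative drift bounds, starting with states far from the mean load *)

Section DriftBounds.
Context (R : realType) (I : nat) (Kbar : {fset config I}).
Hypothesis hK : feasible_configs Kbar.
Context (lambda mu : 'I_I -> R) (p r s M : R).
Hypotheses (lambda_gt0 : forall i, 0 < lambda i) (mu_gt0 : forall i, 0 < mu i).
Hypothesis hrho : \sum_(i < I) lambda i / mu i = 1.
Hypotheses (p_gt : 7 / 8 < p) (p_lt1 : p < 1).
(* [M] bounds all the parameters of the model at once. *)
Hypotheses (M_ge1 : 1 <= M) (I_le : I%:R <= M)
  (lambda_le : forall i, lambda i <= M) (mu_le : forall i, mu i <= M)
  (ln_lambda_le : forall i, `|ln (lambda i)| <= M)
  (ln_mu_le : forall i, `|ln (mu i)| <= M)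
  (config_le : forall a i, a \in Kbar -> (a i)%:R <= M)
  (fact_le : forall a, a \in Kbar -> ln (cfg_fact a)%:R <= M)
  (pairs_le : (I * #|{: Kbar}|)%:R <= M).
Hypotheses (s_ge : 100 * M <= s) (rE : r = s ^+ 8).
Local Notation K := (nonzero_configs Kbar).
Local Notation Z x := ((total_customers x)%:R : R).
Local Notation X0 x := ((zero_servers p x)%:R : R).
Local Notation arr := (arrival_rate lambda p r).
Local Notation dep := (departure_rate mu).
Local Notation pot := (potential p r).
Local Notation imb := (imbalance lambda mu r).
Implicit Types (x : state Kbar) (a : config I) (i : 'I_I).

Lemma M_gt0 : 0 < M. Proof. by move: M_ge1; lra. Qed.
Lemma p_ge0 : 0 <= p. Proof. by move: p_gt; lra. Qed.
Lemma s_ge6 : 6 <= s. Proof. by move: M_ge1 s_ge; lra. Qed.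
Lemma s_ge1 : 1 <= s. Proof. by have := s_ge6; lra. Qed.
Lemma s_gt0 : 0 < s. Proof. by have := s_ge6; lra. Qed.
Lemma r_gt0 : 0 < r. Proof. by rewrite rE exprn_gt0// s_gt0. Qed.
Lemma s_le_r : s <= r. Proof. by rewrite rE ler_eXnr// s_ge1. Qed.
Lemma ln_r_ge0 : 0 <= ln r.
Proof. by rewrite ln_ge0// (le_trans s_ge1 s_le_r). Qed.

Lemma rZ_gt0 x : 0 < r + Z x.
Proof. by rewrite ltr_wpDr// r_gt0. Qed.

Lemma pair_sum_le (F : 'I_I -> config I -> R) (c : R) : 0 <= c ->
  (forall i a, a \in Kbar -> cfg_add a i \in Kbar -> F i a <= c) ->
  \sum_(i < I) \sum_(k : Kbar | cfg_add (val k) i \in Kbar) F i (val k) <= M * c.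
Proof.
move=> c0 hF; apply: (@le_trans _ _ (\sum_(i < I) \sum_(k : Kbar) c)).
  apply: ler_sum => i _; rewrite big_mkcond; apply: ler_sum => k _.
  by case: ifP => // h; apply: hF => //; exact: valP.
rewrite !sumr_const card_ord -mulrnA mulnC -mulr_natl.
by apply: ler_wpM2r.
Qed.

Lemma arrival_rate_le x i a : a \in Kbar -> cfg_add a i \in Kbar ->
  arr x i a <= M * r.
Proof.
move=> aK bK.
have r0 := ltW r_gt0.
apply: (@le_trans _ _ (lambda i * r)); last by rewrite ler_wpM2r.
rewrite -(sum_arrival_rate hK lambda p r x i) (bigD1 [` aK]%fset)//= lerDl.
apply: sumr_ge0 => k _; apply: arrival_rate_ge0 => //; exact: r_gt0.
Qed.

Lemma departure_rate_le x i a : cfg_add a i \in Kbar -> dep x i a <= M ^+ 2 * Z x.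
Proof.
move=> bK; rewrite /departure_rate expr2 ler_pM//.
- by rewrite mulr_ge0// ltW.
- by rewrite ler_pM// ?(ltW (mu_gt0 _))// config_le.
- by rewrite ler_nat count_servers_le.
Qed.

Lemma rate_diff_le x i a : a \in Kbar -> cfg_add a i \in Kbar ->
  `|arr x i a - dep x i a| <= M ^+ 2 * (r + Z x).
Proof.
move=> aK bK; have h1 := arrival_rate_le x aK bK; have h2 := departure_rate_le x bK.
have h3 := arrival_rate_ge0 p lambda_gt0 r_gt0 x i a.
have h4 := departure_rate_ge0 mu_gt0 x i a.
have h5 : M * r <= M ^+ 2 * r.
  by rewrite ler_wpM2r ?(ltW r_gt0)// expr2 ler_peMl// ltW// M_gt0.
by rewrite ler_norml; apply/andP; split; lra.
Qed.

Lemma sum_customersE x : Z x = r + \sum_(i < I) imb x i.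
Proof.
rewrite /imbalance sumrB -mulr_suml hrho mul1r sum_customers natr_sum.
by rewrite addrC subrK.
Qed.

Lemma customers_diff_le x : `|Z x - r| <= \sum_(i < I) `|imb x i|.
Proof. by rewrite sum_customersE addrAC subrr add0r; exact: ler_norm_sum. Qed.

Lemma drift_imbalance_energy_le x :
  drift lambda mu p r (imbalance_energy lambda mu r) x <=
  - \sum_(i < I) imb x i ^+ 2 + 2 * r + M.
Proof.
rewrite drift_imbalance_energy// ?r_gt0//.
rewrite !big_split/= -mulr_suml hrho mul1r -natr_sum -sum_customers sum_customersE.
rewrite -mulr_sumr.
have : \sum_(i < I) imb x i <= \sum_(i < I) (imb x i ^+ 2 + 1).
  by apply: ler_sum => i _; nra.
rewrite [leRHS]big_split/= sumr_const card_ord => h.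
by move: I_le; lra.
Qed.

Lemma potential_bound x a : a \in Kbar -> `|pot x a| <= 2 * ln (r + Z x) + M.
Proof.
move=> aK; have M0 := M_gt0; have r1 := le_trans s_ge1 s_le_r.
have lnr : 0 <= ln r <= ln (r + Z x).
  by rewrite ln_r_ge0/= ler_ln ?posrE ?rZ_gt0 ?r_gt0// lerDl.
rewrite /potential; case: ifP => _; first by rewrite normr0; lra.
have h1 : 0 <= ln ((count_servers x a).+1%:R : R) <= ln (r + Z x).
  apply/andP; split; first by apply: ln_ge0; rewrite ler1n.
  rewrite ler_ln ?posrE ?rZ_gt0//.
  by rewrite -[_.+1%:R]natr1 [leLHS]addrC; apply: lerD => //; rewrite ler_nat count_servers_le.
have h2 := fact_le aK.
have h3 : 0 <= ln (cfg_fact a)%:R :> R by rewrite ln_ge0// ler1n cfg_fact_gt0.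
have h4 : 0 <= p * ln r <= ln r.
  have l0 := ln_r_ge0.
  by rewrite mulr_ge0 ?p_ge0//= ler_piMl// ltW.
rewrite /log_weight ler_norml; apply/andP; split; lra.
Qed.

Lemma available_inv_le1 x i : (available p x i)%:R^-1 <= 1 :> R.
Proof.
case: (available p x i) => [|n]; first by rewrite invr0.
by rewrite invf_le1// ler1n.
Qed.

(** Far from the mean load [r + Z <= 5 * |Z - r|], and [|Z - r|] is at most the sum of the absolute
    imbalances; the factor is [5 ^+ 2] times the [M] of Cauchy-Schwarz. *)
Lemma crude_imbalance x : r / 2 < `|Z x - r| ->
  (r + Z x) ^+ 2 <= 25 * M * \sum_(i < I) imb x i ^+ 2.
Proof.
move=> far.
have h1 : `|Z x - r| ^+ 2 <= M * \sum_(i < I) imb x i ^+ 2.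
  apply: le_trans (sum_abs_sq_le _ M_gt0 I_le).
  by rewrite lerXn2r ?nnegrE ?sumr_ge0// customers_diff_le.
have h2 : r + Z x <= 5 * `|Z x - r|.
  have [/ger0_norm e|/ltr0_norm e] := leP 0 (Z x - r); rewrite e; rewrite e in far;
  have := r_gt0; lra.
have h3 : (r + Z x) ^+ 2 <= (5 * `|Z x - r|) ^+ 2.
  by rewrite lerXn2r ?nnegrE ?mulr_ge0// addr_ge0// ltW// r_gt0.
rewrite exprMn in h3; lra.
Qed.

(** No cancellation is used: each net flow is bounded by its size and each potential by a logarithm.
    This holds in all states, including those with arbitrarily many customers. *)
Lemma drift_entropy_crude x :
  drift lambda mu p r (entropy p r) x <= 10 * M ^+ 4 * (r + Z x) * (1 + ln (r + Z x)).
Proof.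
apply: le_trans (drift_entropy_le hK p lambda_gt0 mu_gt0 r_gt0 x) _.
have M0 := M_gt0; have r0 := r_gt0; have r1 := le_trans s_ge1 s_le_r.
have ln0 : 0 <= ln (r + Z x).
  by rewrite ln_ge0// (le_trans r1)// lerDl.
set m := r + Z x; have m0 : 1 <= m by rewrite (le_trans r1)// lerDl.
set l := ln m in ln0 *.
rewrite (_ : 10 * _ * _ * _ = M * (10 * M ^+ 3 * m * (1 + l))); last by ring.
have M3 : 0 <= M ^+ 3 * m * (1 + l).
  by rewrite !mulr_ge0 ?exprn_ge0//; lra.
apply: (pair_sum_le (F := fun i a => (arr x i a - dep x i a) *
  (pot x (cfg_add a i) - pot x a) + lambda i * r / (available p x i)%:R
   + mu i * (cfg_add a i i)%:R)); first by lra.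
move=> i a aK bK.
have h1 : (arr x i a - dep x i a) * (pot x (cfg_add a i) - pot x a) <=
    M ^+ 2 * m * (4 * l + 2 * M).
  apply: le_trans (ler_norm _) _; rewrite normrM ler_pM// ?rate_diff_le//.
  apply: le_trans (ler_normB _ _) _.
  by have := potential_bound x aK; have := potential_bound x bK; rewrite -/m -/l; lra.
have h2 : lambda i * r / (available p x i)%:R <= M * m.
  apply: (@le_trans _ _ (lambda i * r)).
    by rewrite ler_piMr ?available_inv_le1// mulr_ge0// ltW.
  by apply: ler_pM => //; rewrite ?lerDl// ltW.
have h3 : mu i * (cfg_add a i i)%:R <= M ^+ 2.
  by rewrite expr2 ler_pM ?config_le// ltW.
have A1 : M ^+ 2 <= M ^+ 3 by apply: ler_weXn2l.
have A2 : M <= M ^+ 3 by rewrite -[leLHS]expr1; apply: ler_weXn2l.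
have A3 : M ^+ 2 * m <= M ^+ 3 * m by rewrite ler_wpM2r//; lra.
have A4 : M * m <= M ^+ 3 * m by rewrite ler_wpM2r//; lra.
have A5 : M ^+ 2 <= M ^+ 3 * m by rewrite (le_trans A1)// ler_peMr// exprn_ge0// ltW.
have A6 : M ^+ 2 * m * l <= M ^+ 3 * m * l by rewrite ler_wpM2r.
have A7 : M ^+ 2 * m * (4 * l + 2 * M) = 4 * (M ^+ 2 * m * l) + 2 * (M ^+ 3 * m).
  by ring.
rewrite A7 in h1.
rewrite (_ : 10 * M ^+ 3 * m * (1 + l) =
  10 * (M ^+ 3 * m * l) + 10 * (M ^+ 3 * m)); last by ring.
have A0 : 0 <= M ^+ 3 * m * l by rewrite !mulr_ge0 ?exprn_ge0//; lra.
lra.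
Qed.

(** For states with many customers [q] replaces [s] as the eighth root of the system size. *)
Lemma crude_scale x : exists q, [/\ s <= q, r + Z x = q ^+ 8 & ln (r + Z x) <= 8 * q].
Proof.
have m0 := rZ_gt0 x; exists ((r + Z x) `^ (8^-1)).
have q8 : r + Z x = ((r + Z x) `^ (8^-1)) ^+ 8.
  by rewrite -powR_mulrn ?powR_ge0// -powRrM mulVf// powRr1// ltW.
have sq : s <= (r + Z x) `^ 8^-1.
  rewrite -(@ler_pXn2r _ 8)// ?nnegrE ?powR_ge0 ?(ltW s_gt0)//.
  by rewrite -q8 -rE lerDl.
split=> //; rewrite {1}q8; apply: ln_scale; exact: le_trans s_ge1 sq.
Qed.

(** The crude bound is [O(q ^+ 9)], while the squared imbalances sum to at least
    [q ^+ 16 / (25 * M)]; dividing by [s ^+ 2 <= q ^+ 2] leaves ample room. *)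
Lemma drift_entropy_far x : r / 2 < `|Z x - r| ->
  drift lambda mu p r (entropy p r) x <=
  (\sum_(i < I) imb x i ^+ 2) / s ^+ 2 / 2.
Proof.
move=> far; have far2 := crude_imbalance far.
apply: le_trans (drift_entropy_crude x) _.
have [q [sq mE lnm]] := crude_scale x.
rewrite mE in far2 lnm *; set D := \sum_(i < I) _ in far2 *.
have M0 := M_gt0; have s0 := s_gt0; have s6 := s_ge; have M1 := M_ge1.
have q0 : 0 < q by lra.
have Mn n : 0 <= M ^+ n by rewrite exprn_ge0// ltW.
have qn n : 0 <= q ^+ n by rewrite exprn_ge0// ltW.
apply: (@le_trans _ _ (90 * M ^+ 4 * q ^+ 9)).
  have -> : 90 * M ^+ 4 * q ^+ 9 = 10 * M ^+ 4 * q ^+ 8 * (9 * q) by ring.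
  by apply: ler_wpM2l; [apply: mulr_ge0 => //; apply: mulr_ge0 | lra].
rewrite ler_pdivlMr// ler_pdivlMr ?exprn_gt0//.
rewrite -(ler_pM2l (_ : 0 < 25 * M)); last by lra.
apply: le_trans far2.
(* The accumulated constant is [25 * M * 2 * 90 * M ^+ 4]; its five factors [M] are paid by five
   factors [q >= 100 * M]. *)
have h : (90 * M) * ((50 * M) * M ^+ 3) <= q * (q * q ^+ 3).
  apply: ler_pM; [lra| |lra|].
    by apply: mulr_ge0; [lra | exact: Mn].
  apply: ler_pM; [lra|exact: Mn|lra|].
  by apply: lerXn2r; rewrite ?nnegrE; lra.
have s2q : s ^+ 2 <= q ^+ 2 by apply: lerXn2r; rewrite ?nnegrE; lra.
rewrite (_ : 25 * M * _ = (90 * M) * ((50 * M) * M ^+ 3) * (q ^+ 9 * s ^+ 2));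
  last by ring.
rewrite (_ : (q ^+ 8) ^+ 2 = q * (q * q ^+ 3) * (q ^+ 9 * q ^+ 2)); last by ring.
apply: ler_pM => //; last by rewrite ler_wpM2l.
  by apply: mulr_ge0; [lra | apply: mulr_ge0; [lra | exact: Mn]].
by apply: mulr_ge0 => //; exact: sqr_ge0.
Qed.

(** * Flows when the number of customers is within [r / 2] of [r] *)

Local Notation bulk x := (`|Z x - r| <= r / 2).
Local Notation theta := (r `^ p).

Lemma theta_bounds : s ^+ 7 <= theta <= r.
Proof. by rewrite rE powR_scale// s_ge1. Qed.

Lemma r_le_theta : r <= s * theta.
Proof.
have /andP[h _] := theta_bounds; rewrite {1}rE exprS.
by apply: ler_wpM2l => //; exact: ltW s_gt0.
Qed.

Lemma s_le_theta : s <= theta.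
Proof.
have /andP[h _] := theta_bounds; apply: le_trans h.
by rewrite ler_eXnr// s_ge1.
Qed.

Lemma bulk_customers x : bulk x -> r / 2 <= Z x <= 3 / 2 * r.
Proof. by rewrite ler_norml => /andP[h1 h2]; apply/andP; split; lra. Qed.

Lemma bulk_power x : bulk x -> theta / 2 <= Z x `^ p <= 2 * theta.
Proof.
move=> /bulk_customers/andP[h1 h2]; have r0 := r_gt0; have p0 := p_ge0.
have two : 2 `^ p <= 2 :> R by apply: ler1_powR; [rewrite ler1n | exact: ltW p_lt1].
have e1 : theta <= 2 `^ p * Z x `^ p.
  by rewrite -powRM//; apply: ge0_ler_powR; rewrite ?nnegrE; lra.
have e2 : Z x `^ p <= 2 `^ p * theta.
  by rewrite -powRM//; [apply: ge0_ler_powR; rewrite ?nnegrE; lra | lra].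
have Zp := powR_ge0 (Z x) p; have tp := powR_ge0 r p.
by apply/andP; split; nra.
Qed.

Lemma bulk_zero_servers x : bulk x -> theta / 2 <= X0 x <= 3 * theta.
Proof.
move=> b; have /andP[h1 h2] := bulk_power b.
have h3 := zero_servers_ge p x; have h4 := zero_servers_le p x.
have := s_le_theta; have := s_ge1 => h5 h6.
by apply/andP; split; lra.
Qed.

Lemma bulk_available x i : bulk x -> theta / 2 <= (available p x i)%:R <= 5 * r.
Proof.
move=> b; have /andP[h1 h2] := bulk_zero_servers b.
have /andP[h3 h4] := bulk_customers b.
have /andP[_ h5] := theta_bounds.
apply/andP; split; last by apply: le_trans (sum_count_available p x i) _; lra.
by apply: le_trans h1 _; rewrite ler_nat zero_servers_available.
Qed.

Lemma bulk_occupancy x a : bulk x -> 1 <= occupancy p x a <= 5 * r.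
Proof.
move=> b; have /andP[h1 h2] := bulk_zero_servers b.
have /andP[h3 h4] := bulk_customers b.
have /andP[_ h5] := theta_bounds; have h6 := s_le_theta; have h7 := s_ge6.
rewrite /occupancy; case: ifP => _; first by apply/andP; split; lra.
rewrite ler1n/= -natr1.
have : (count_servers x a)%:R <= Z x by rewrite ler_nat count_servers_le.
have := s_le_r; lra.
Qed.

Lemma ln_5r_le : ln (5 * r) <= 16 * s.
Proof.
have h1 := s_le_r; have h2 := s_ge6; have r0 := r_gt0.
rewrite lnM ?posrE; [|lra..].
have e : ln r <= 8 * s by rewrite {1}rE; apply: ln_scale s_ge1.
have : ln 5 <= ln r by rewrite ler_ln ?posrE; lra.
lra.
Qed.

Lemma ln_between (y : R) : 1 <= y <= 5 * r -> 0 <= ln y <= 16 * s.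
Proof.
move=> /andP[h1 h2]; rewrite ln_ge0//=; apply: le_trans ln_5r_le.
by rewrite ler_ln ?posrE//; lra.
Qed.

(** Measures how well [p * ln r] replaces the true logarithm. The change from [r] to [Z] costs
    [O(|Z - r| / r)], rounding up costs [1 / Z ^ p], and [r / Z ^ p <= 2 * s]. The factor [r] is
    there because the error will be multiplied by flows of order [r]. *)
Lemma bulk_zero_servers_ln x : bulk x ->
  r * `|ln (X0 x) - p * ln r| <= 2 * `|Z x - r| + 2 * s.
Proof.
move=> b; have /andP[z1 z2] := bulk_customers b; have r0 := r_gt0.
have Z0 : 0 < Z x by lra.
have t0 : 0 < theta by rewrite powR_gt0.
have Zp0 : 0 < Z x `^ p by rewrite powR_gt0.
have /andP[q1 _] := bulk_power b.
have x1 := zero_servers_ge p x; have x2 := zero_servers_le p x.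
have x0 : 0 < X0 x by lra.
have p0 := p_ge0; have p1 := p_lt1.
have lo : r * (p * ln r - ln (X0 x)) <= 2 * `|Z x - r|.
  have : p * ln (Z x) <= ln (X0 x) by rewrite -ln_powR ler_ln ?posrE.
  have : ln (r / Z x) <= r / Z x - 1 by apply: ln_le_sub1; rewrite divr_gt0.
  rewrite ln_div ?posrE// => h1 h2.
  have h3 : p * ln r - ln (X0 x) <= `|Z x - r| / Z x.
    apply: (@le_trans _ _ (p * ((r - Z x) / Z x))).
      rewrite mulrBl divff ?gt_eqF//; nra.
    apply: (@le_trans _ _ (p * (`|Z x - r| / Z x))).
      by rewrite ler_wpM2l// ler_pM2r ?invr_gt0// -normrN opprB ler_norm.
    by apply: ler_piMl; [rewrite divr_ge0// ltW | exact: ltW].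
  apply: (@le_trans _ _ (r * (`|Z x - r| / Z x))); first by rewrite ler_pM2l.
  rewrite mulrA ler_pdivrMr//.
  by have := normr_ge0 (Z x - r); nra.
have up : r * (ln (X0 x) - p * ln r) <= `|Z x - r| + 2 * s.
  have h1 : ln (X0 x) <= p * ln (Z x) + (Z x `^ p)^-1.
    rewrite -ln_powR.
    apply: (@le_trans _ _ (ln (Z x `^ p * (1 + (Z x `^ p)^-1)))).
      rewrite ler_ln ?posrE//; last by rewrite mulr_gt0// addr_gt0// invr_gt0.
      by rewrite mulrDr mulr1 divff// gt_eqF.
    rewrite lnM ?posrE// ?addr_gt0 ?invr_gt0//.
    have := @le_ln1Dx _ (Z x `^ p)^-1.
    have : 0 < (Z x `^ p)^-1 by rewrite invr_gt0.
    move=> h3 /(_ _); rewrite lerD2l; apply; lra.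
  have h2 : ln (Z x / r) <= Z x / r - 1 by apply: ln_le_sub1; rewrite divr_gt0.
  rewrite ln_div ?posrE// in h2.
  have h3 : r * (p * (ln (Z x) - ln r)) <= `|Z x - r|.
    apply: (@le_trans _ _ (p * (Z x - r))).
      rewrite mulrCA ler_wpM2l//.
      have -> : Z x - r = r * (Z x / r - 1) by field; rewrite gt_eqF.
      by rewrite ler_pM2l.
    apply: (@le_trans _ _ (p * `|Z x - r|)); first by rewrite ler_wpM2l// ler_norm.
    by apply: ler_piMl => //; exact: ltW.
  have h4 : r * (Z x `^ p)^-1 <= 2 * s.
    rewrite ler_pdivrMr//; have := r_le_theta; have := s_gt0; nra.
  have h5 : r * ln (X0 x) <= r * (p * ln (Z x) + (Z x `^ p)^-1) by rewrite ler_pM2l.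
  lra.
have s0 := s_gt0.
have := normr_ge0 (Z x - r).
have [h|h] := leP 0 (ln (X0 x) - p * ln r) => n0.
  rewrite (ger0_norm h); lra.
rewrite (ltr0_norm h) opprB; lra.
Qed.
Local Notation up := (upflow lambda p r).
Local Notation down := (downflow mu p).
Local Notation diss := (dissipation lambda mu p r).
(** The multiplier [nu_i] of the overview with opposite sign: the part of a log flow ratio that
    depends on the customer type only. *)
Local Notation skew x i :=
  (ln (mu i) + ln (available p x i)%:R - ln (lambda i) - ln r).

Lemma cfg_add_gt0 a i : 1 <= (cfg_add a i i)%:R :> R.
Proof. by rewrite cfg_addE eqxx addn1 ler1n. Qed.

Lemma bulk_available_gt0 x i : bulk x -> 1 <= (available p x i)%:R :> R.
Proof.
move=> /(bulk_available i)/andP[h _]; rewrite ler1n -(ltr_nat R).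
by have := s_le_theta; have := s_ge6; lra.
Qed.

Lemma upflow_gt0 x i a : bulk x -> 0 < up x i a.
Proof.
move=> b; have A := bulk_available_gt0 i b.
have /andP[oc _] := bulk_occupancy a b.
by rewrite /upflow divr_gt0// ?mulr_gt0// ?r_gt0//; lra.
Qed.

Lemma downflow_gt0 x i a : bulk x -> 0 < down x i a.
Proof.
move=> b; have := cfg_add_gt0 a i => h.
have /andP[oc _] := bulk_occupancy (cfg_add a i) b.
by rewrite /downflow ?mulr_gt0//; lra.
Qed.

Lemma ln_upflow x i a : bulk x ->
  ln (up x i a) =
  ln (lambda i) + ln r + ln (occupancy p x a) - ln (available p x i)%:R.
Proof.
move=> b; have A := bulk_available_gt0 i b; have r0 := r_gt0.
have /andP[oc _] := bulk_occupancy a b.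
by rewrite /upflow ln_div ?lnM ?posrE ?mulr_gt0//; lra.
Qed.

Lemma ln_downflow x i a : bulk x ->
  ln (down x i a) =
  ln (mu i) + ln (cfg_add a i i)%:R + ln (occupancy p x (cfg_add a i)).
Proof.
move=> b; have := cfg_add_gt0 a i => h.
have /andP[oc _] := bulk_occupancy (cfg_add a i) b.
by rewrite /downflow !lnM ?posrE ?mulr_gt0//; lra.
Qed.

Lemma ln_flow_ratio x i a : bulk x -> ln (down x i a / up x i a) =
  ln (cfg_add a i i)%:R + ln (occupancy p x (cfg_add a i))
  - ln (occupancy p x a) + skew x i.
Proof.
move=> b; rewrite ln_div ?posrE ?upflow_gt0 ?downflow_gt0//.
by rewrite ln_upflow// ln_downflow//; ring.
Qed.

Lemma ln_r_le : 0 <= ln r <= 8 * s.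
Proof. by rewrite ln_r_ge0 {1}rE/= ln_scale// s_ge1. Qed.

Lemma M_le_Ms : M <= M * s.
Proof. by rewrite ler_peMr ?(ltW M_gt0)// s_ge1. Qed.

Lemma s_le_Ms : s <= M * s.
Proof. by rewrite ler_peMl// ltW// s_gt0. Qed.

Lemma ln_available x i : bulk x -> 0 <= ln ((available p x i)%:R : R) <= 16 * s.
Proof.
move=> b; apply: ln_between; rewrite bulk_available_gt0//=.
by have /andP[_ ->] := bulk_available i b.
Qed.

Lemma ln_flow_ratio_le x i a : bulk x -> cfg_add a i \in Kbar ->
  `|ln (down x i a / up x i a)| <= 35 * (M * s).
Proof.
move=> b bK; rewrite ln_flow_ratio//.
have /andP[a1 a2] := ln_between (bulk_occupancy a b).
have /andP[b1 b2] := ln_between (bulk_occupancy (cfg_add a i) b).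
have /andP[c1 c2] := ln_available i b.
have /andP[d1 d2] := ln_r_le.
have k1 := cfg_add_gt0 a i.
have e1 : 0 <= ln (cfg_add a i i)%:R :> R by rewrite ln_ge0.
have e2 : ln (cfg_add a i i)%:R <= M.
  by apply: le_trans (config_le i bK); apply: ln_le_self; lra.
have := ln_mu_le i; have := ln_lambda_le i.
rewrite !ler_norml => /andP[l1 l2] /andP[m1 m2].
have := M_le_Ms; have := s_le_Ms => f1 f2.
by apply/andP; split; lra.
Qed.

Lemma skew_le x i : bulk x -> `|skew x i| <= 26 * (M * s).
Proof.
move=> b; have /andP[c1 c2] := ln_available i b.
have /andP[d1 d2] := ln_r_le.
have := ln_mu_le i; have := ln_lambda_le i.
rewrite !ler_norml => /andP[l1 l2] /andP[m1 m2].
have := M_le_Ms; have := s_le_Ms => f1 f2.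
by apply/andP; split; lra.
Qed.

(** The two copies of [p * ln r] cancel, except at the zero configuration, where one of them faces
    [ln X0]; the quotient of factorials is the factor [cfg_add a i i] of [downflow]. *)
Lemma potential_diff x i a : bulk x -> a \in Kbar ->
  pot x (cfg_add a i) - pot x a =
  ln (down x i a / up x i a) - skew x i +
  (a == cfg0 I)%:R * (ln (X0 x) - p * ln r).
Proof.
move=> b aK; rewrite ln_flow_ratio// /potential (negbTE (cfg_add_neq0 _ _)).
rewrite /log_weight cfg_fact_add natrM lnM ?posrE ?ltr0n ?cfg_fact_gt0//; last first.
  by rewrite cfg_addE eqxx addn1.
rewrite {1}/occupancy (negbTE (cfg_add_neq0 _ _)).
rewrite /occupancy; have [a0|a0] := eqVneq a (cfg0 I); last by rewrite /= mul0r; ring.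
have -> : cfg_fact a = 1%N.
  by rewrite /cfg_fact big1// => j _; rewrite a0 ffunE.
by rewrite ln1 /= mul1r; ring.
Qed.

Lemma rate_available_le x i : bulk x ->
  0 <= lambda i * r / (available p x i)%:R <= 2 * (M * s).
Proof.
move=> b; have A := bulk_available_gt0 i b; have r0 := r_gt0.
have /andP[h _] := bulk_available i b.
have l0 := ltW (lambda_gt0 i).
apply/andP; split; first by rewrite divr_ge0 ?mulr_ge0// ltW.
rewrite ler_pdivrMr; last by lra.
apply: (@le_trans _ _ (M * (s * theta))).
  by apply: ler_pM => //; [exact: ltW | exact: r_le_theta].
have : 0 <= M * s by rewrite mulr_ge0 ?ltW ?M_gt0 ?s_gt0.
rewrite mulrA; nra.
Qed.

Lemma arrival_rate_upflow x i a : bulk x -> a \in Kbar ->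
  `|arr x i a - up x i a| <= 2 * (M * s).
Proof.
move=> b aK; have /andP[h1 h2] := rate_available_le i b.
have A0 : available p x i != 0%N.
  by have := bulk_available_gt0 i b; rewrite ler1n -lt0n.
rewrite /arrival_rate /upflow /placement_prob (negbTE A0) /occupancy.
case: (eqVneq a (cfg0 I)) => a0.
  rewrite a0 (_ : servers p x _ = zero_servers p x); last by rewrite /servers eqxx.
  by rewrite [_ * _ * (_ / _)]mulrA subrr normr0; lra.
rewrite servers_nonzero//.
rewrite (_ : _ - _ = - (lambda i * r / (available p x i)%:R)).
  by rewrite normrN ger0_norm.
by rewrite -natr1; ring.
Qed.

Lemma departure_rate_downflow x i a : cfg_add a i \in Kbar ->
  `|dep x i a - down x i a| <= M ^+ 2.
Proof.
move=> bK.
rewrite /departure_rate /downflow /occupancy (negbTE (cfg_add_neq0 _ _)).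
rewrite -[_.+1%:R]natr1 (_ : _ - _ = - (mu i * (cfg_add a i i)%:R)); last by ring.
rewrite normrN ger0_norm; last by apply: mulr_ge0 => //; exact: ltW.
by rewrite expr2; apply: ler_pM; rewrite ?(ltW (mu_gt0 i))// config_le.
Qed.

(** The net flow times the log ratio is minus the dissipation, once true rates are replaced by
    regularised flows. The [skew] term is kept exact because it collapses when summed over
    configurations. *)
Lemma entropy_pair_bulk x i a : bulk x -> a \in Kbar -> cfg_add a i \in Kbar ->
  (arr x i a - dep x i a) * (pot x (cfg_add a i) - pot x a)
    + lambda i * r / (available p x i)%:R + mu i * (cfg_add a i i)%:R <=
  - diss x i a - (arr x i a - dep x i a) * skew x i
    + (113 * M ^+ 3 * s ^+ 2 + 5 * M ^+ 2 * `|Z x - r|).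
Proof.
move=> b aK bK; rewrite potential_diff//.
have M1 := M_ge1; have s6 := s_ge6; have M0 := M_gt0; have r0 := r_gt0.
have /andP[_ h1] := rate_available_le i b.
have h2 := arrival_rate_upflow i b aK.
have h3 := departure_rate_downflow x bK.
have h4 := ln_flow_ratio_le b bK.
have h5 : mu i * (cfg_add a i i)%:R <= M ^+ 2.
  by rewrite expr2; apply: ler_pM; rewrite ?(ltW (mu_gt0 i))// config_le.
have h6 := rate_diff_le x aK bK.
have h7 := bulk_zero_servers_ln b.
have /andP[z1 z2] := bulk_customers b.
rewrite /dissipation; set g := ln (down x i a / up x i a) in h4 *.
set t := ln (X0 x) - p * ln r in h7 *.
set ba := arr x i a - dep x i a in h6 *.
have t1 : ba * ((a == cfg0 I)%:R * t) <= 5 * M ^+ 2 * (`|Z x - r| + s).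
  apply: le_trans (ler_norm _) _; rewrite normrM.
  have : `|(a == cfg0 I)%:R * t| <= `|t|.
    by rewrite normrM; case: (a == _); rewrite ?normr1 ?mul1r// normr0 mul0r.
  move=> h8; apply: (@le_trans _ _ (M ^+ 2 * (r + Z x) * `|t|)).
    by apply: ler_pM.
  rewrite (_ : M ^+ 2 * _ * _ = M ^+ 2 * ((r + Z x) * `|t|)); last by ring.
  rewrite (_ : 5 * M ^+ 2 * _ = M ^+ 2 * (5 * (`|Z x - r| + s))); last by ring.
  apply: ler_wpM2l; first by rewrite exprn_ge0// ltW.
  have : (r + Z x) * `|t| <= (5 / 2 * r) * `|t| by rewrite ler_wpM2r//; lra.
  lra.
have t2 : (ba - (up x i a - down x i a)) * g <=
    (2 * (M * s) + M ^+ 2) * (35 * (M * s)).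
  apply: le_trans (ler_norm _) _; rewrite normrM; apply: ler_pM => //.
  rewrite (_ : ba - _ = (arr x i a - up x i a) - (dep x i a - down x i a)).
    by apply: le_trans (ler_normB _ _) _; lra.
  by rewrite /ba; ring.
have c1 : M ^+ 2 * s ^+ 2 <= M ^+ 3 * s ^+ 2.
  by rewrite ler_wpM2r ?sqr_ge0//; apply: ler_weXn2l.
have c2 : M ^+ 3 * s <= M ^+ 3 * s ^+ 2.
  rewrite ler_wpM2l ?exprn_ge0 ?(ltW M0)// -[leLHS]expr1.
  by apply: ler_weXn2l => //; lra.
have c3 : M ^+ 2 * s <= M ^+ 3 * s.
  by rewrite ler_wpM2r//; [lra | apply: ler_weXn2l].
have c4 : M * s <= M ^+ 3 * s.
  by rewrite ler_wpM2r//; [lra | rewrite -[leLHS]expr1; apply: ler_weXn2l].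
have c5 : M ^+ 2 <= M ^+ 2 * s by rewrite ler_peMr ?exprn_ge0// ?(ltW M0)//; lra.
(* The constant 113 is [70 + 35] from this product, 5 from the zero-servers, and [2 + 1] from the
   shifts by one in [entropy_arrival] and [entropy_departure]. *)
have e : (2 * (M * s) + M ^+ 2) * (35 * (M * s)) =
  70 * (M ^+ 2 * s ^+ 2) + 35 * (M ^+ 3 * s) by ring.
rewrite e in t2.
have e2 : ba * (g - skew x i + (a == cfg0 I)%:R * t) =
   - ((down x i a - up x i a) * g) - ba * skew x i
   + (ba - (up x i a - down x i a)) * g + ba * ((a == cfg0 I)%:R * t) by ring.
rewrite e2; lra.
Qed.

(** * Drift of the Lyapunov function and the balanced states *)

Local Notation spread x := (\sum_(i < I) imb x i ^+ 2).

(** The bound [2 * s ^+ 9] on the spread says that the penalty term [spread / s ^+ 2 / 2] is at most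
    [s ^+ 7]. *)
Definition near_balance x : bool :=
  [&& `|Z x - r| <= r / 2, spread x <= 2 * s ^+ 9 &
    [forall i : 'I_I, forall k : Kbar, (cfg_add (val k) i \in Kbar) ==>
       (diss x i (val k) <= s ^+ 7)]].

Definition total_dissipation x : R :=
  \sum_(i < I) \sum_(k : Kbar | cfg_add (val k) i \in Kbar) diss x i (val k).

Lemma dissipation_ge0 x i a : bulk x -> 0 <= diss x i a.
Proof.
by move=> b; apply: gt0_dissipation_ge0; [exact: downflow_gt0 | exact: upflow_gt0].
Qed.

Lemma dissipation_le_total x i (k : Kbar) : bulk x ->
  cfg_add (val k) i \in Kbar -> diss x i (val k) <= total_dissipation x.
Proof.
move=> b hk; rewrite /total_dissipation (bigD1 i)//= (bigD1 k)//= -addrA lerDl.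
by apply: addr_ge0; apply: sumr_ge0 => j _; [|apply: sumr_ge0 => l _];
  exact: dissipation_ge0.
Qed.

(** For fixed [i] the net flows of all configurations add up to [lambda i * r - mu i * Y_i], that is
    [- mu i * imbalance]. Hence the large factor [skew] meets only the imbalance, not flows of order
    [r]. *)
Lemma drift_entropy_bulk x : bulk x ->
  drift lambda mu p r (entropy p r) x <= - total_dissipation x
    + 31 * M ^+ 3 * s * \sum_(i < I) `|imb x i| + 113 * M ^+ 4 * s ^+ 2.
Proof.
move=> b; have M1 := M_ge1; have M0 := M_gt0; have s0 := s_gt0.
apply: le_trans (drift_entropy_le hK p lambda_gt0 mu_gt0 r_gt0 x) _.
set c := 113 * M ^+ 3 * s ^+ 2 + 5 * M ^+ 2 * `|Z x - r|.
have c0 : 0 <= c.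
  have Mn n : 0 <= M ^+ n by rewrite exprn_ge0// ltW.
  apply: addr_ge0; apply: mulr_ge0 => //; last exact: mulr_ge0.
    exact: mulr_ge0.
  exact: sqr_ge0.
apply: (@le_trans _ _ (- total_dissipation x
    + \sum_(i < I) skew x i * (mu i * imb x i) + M * c)).
  rewrite -lerBlDl.
  have -> : - total_dissipation x + \sum_(i < I) skew x i * (mu i * imb x i) =
    \sum_(i < I) \sum_(k : Kbar | cfg_add (val k) i \in Kbar)
     (- diss x i (val k) - (arr x i (val k) - dep x i (val k)) * skew x i).
    rewrite /total_dissipation -sumrN -big_split/=; apply: eq_bigr => i _.
    rewrite big_split/= -sumrN; congr (_ + _).
    rewrite sumrN -mulr_suml sumrB sum_arrival_rate// sum_departure_rate//.
    by rewrite /imbalance; field; rewrite gt_eqF.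
  rewrite -sumrB; under eq_bigr do rewrite -sumrB.
  apply: (pair_sum_le (F := fun i a =>
    (arr x i a - dep x i a) * (pot x (cfg_add a i) - pot x a) +
     lambda i * r / (available p x i)%:R + mu i * (cfg_add a i i)%:R -
     (- diss x i a - (arr x i a - dep x i a) * skew x i))) => //.
  by move=> i a aK bK; rewrite lerBlDl; apply: entropy_pair_bulk.
have h1 : \sum_(i < I) skew x i * (mu i * imb x i) <=
    26 * M ^+ 2 * s * \sum_(i < I) `|imb x i|.
  rewrite mulr_sumr; apply: ler_sum => i _.
  apply: le_trans (ler_norm _) _; rewrite !normrM mulrA.
  apply: ler_wpM2r => //; rewrite (ger0_norm (ltW (mu_gt0 i))).
  rewrite (_ : 26 * M ^+ 2 * s = 26 * (M * s) * M); last by ring.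
  by apply: ler_pM => //; [exact: ltW | exact: skew_le].
have h2 := customers_diff_le x.
set S := \sum_(i < I) `|imb x i| in h1 h2 *.
have S0 : 0 <= S by apply: sumr_ge0.
have h3 : M * c <= 113 * M ^+ 4 * s ^+ 2 + 5 * M ^+ 3 * s * S.
  rewrite (_ : M * c = 113 * M ^+ 4 * s ^+ 2 + 5 * M ^+ 3 * `|Z x - r|); last first.
    by rewrite /c; ring.
  rewrite lerD2l (_ : _ * s * S = 5 * M ^+ 3 * (s * S)); last by ring.
  apply: ler_wpM2l; first by rewrite mulr_ge0// exprn_ge0// ltW.
  by apply: le_trans h2 _; rewrite ler_peMl// s_ge1.
have h4 : 26 * M ^+ 2 * s * S <= 26 * M ^+ 3 * s * S.
  apply: ler_wpM2r => //; apply: ler_wpM2r; first exact: ltW.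
  by apply: ler_wpM2l => //; exact: ler_weXn2l.
have e : 31 * M ^+ 3 * s * S = 26 * M ^+ 3 * s * S + 5 * M ^+ 3 * s * S by ring.
rewrite e; lra.
Qed.

(** In order: the completed square of the linear imbalance term, the error of the bulk entropy
    drift, and the drift of [imbalance_energy]. *)
Definition drift_constant : R := M * (31 * M ^+ 3) ^+ 2 + 113 * M ^+ 4 + 2 + M.

Lemma drift_constant_ge0 : 0 <= drift_constant.
Proof.
have M0 := M_gt0; rewrite /drift_constant.
apply: addr_ge0; last exact: ltW.
apply: addr_ge0 => //; apply: addr_ge0; apply: mulr_ge0 => //.
- exact: ltW.
- exact: sqr_ge0.
- by rewrite exprn_ge0// ltW.
Qed.

(** The term [2 * r] of the imbalance drift, weighted by [s ^- 2], is the source of the order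
    [s ^+ 6]. *)
Lemma drift_lyapunovE x :
  drift lambda mu p r (lyapunov lambda mu p r (s ^- 2)) x <=
  drift lambda mu p r (entropy p r) x - spread x / s ^+ 2
   + (2 + M) * s ^+ 6.
Proof.
have M0 := M_gt0; have s0 := s_gt0; have s1 := s_ge1.
rewrite /lyapunov driftD driftZ -[leRHS]addrA lerD2l.
apply: (@le_trans _ _ (s ^- 2 * (- spread x + 2 * r + M))).
  by rewrite ler_pM2l ?invr_gt0 ?exprn_gt0// drift_imbalance_energy_le.
set V := spread x.
rewrite (_ : s ^- 2 * _ = - (V / s ^+ 2) + (2 * s ^+ 6 + M / s ^+ 2));
  last by rewrite rE; field; rewrite gt_eqF.
rewrite lerD2l [(2 + M) * _]mulrDl lerD2l ler_wpM2l ?(ltW M0)//.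
apply: (@le_trans _ _ 1); last by rewrite exprn_ege1.
by rewrite invf_le1 ?exprn_gt0// exprn_ege1.
Qed.

(** Half of the penalty pays for the entropy drift; the other half exceeds [s ^+ 7], as the spread
    is at least [s ^+ 16 / (25 * M)]. *)
Lemma drift_lyapunov_far x : ~~ (bulk x) ->
  drift lambda mu p r (lyapunov lambda mu p r (s ^- 2)) x <=
  drift_constant * s ^+ 6 - s ^+ 7.
Proof.
rewrite -ltNge => far; have M0 := M_gt0; have s0 := s_gt0; have s1 := s_ge1.
have sn n : 0 <= s ^+ n by rewrite exprn_ge0// ltW.
apply: le_trans (drift_lyapunovE x) _.
have h1 := drift_entropy_far far.
have h2 : s ^+ 7 <= spread x / s ^+ 2 / 2.
  have h3 := crude_imbalance far.
  have h4 : s ^+ 16 <= 25 * M * spread x.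
    apply: le_trans h3; rewrite (_ : s ^+ 16 = r ^+ 2); last by rewrite rE -exprM.
    by apply: lerXn2r; rewrite ?nnegrE ?(ltW r_gt0) ?(ltW (rZ_gt0 x))// lerDl.
  rewrite ler_pdivlMr// ler_pdivlMr ?exprn_gt0//.
  rewrite -(ler_pM2l (_ : 0 < 25 * M)); last by lra.
  apply: le_trans h4.
  rewrite (_ : 25 * M * _ = 50 * M * s ^+ 9); last by ring.
  apply: (@le_trans _ _ (s * s ^+ 9)); first by apply: ler_wpM2r => //; move: s_ge; lra.
  by rewrite -exprS; apply: ler_weXn2l.
have h5 : (2 + M) * s ^+ 6 <= drift_constant * s ^+ 6.
  apply: ler_wpM2r => //.
  have A0 : 0 <= M * (31 * M ^+ 3) ^+ 2 by apply: mulr_ge0; [exact: ltW|exact: sqr_ge0].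
  have B0 : 0 <= 113 * M ^+ 4 by apply: mulr_ge0 => //; rewrite exprn_ge0// ltW.
  by rewrite /drift_constant; lra.
lra.
Qed.

Lemma drift_lyapunov_bulk x : bulk x ->
  drift lambda mu p r (lyapunov lambda mu p r (s ^- 2)) x <=
  drift_constant * s ^+ 6 - (total_dissipation x + spread x / s ^+ 2 / 2).
Proof.
move=> b; have M0 := M_gt0; have s0 := s_gt0; have s1 := s_ge1.
have sn n : 0 <= s ^+ n by rewrite exprn_ge0// ltW.
apply: le_trans (drift_lyapunovE x) _.
have h1 := drift_entropy_bulk b.
have h2 : 31 * M ^+ 3 * s * (\sum_(i < I) `|imb x i|) <=
    spread x / s ^+ 2 / 2 + M * ((31 * M ^+ 3) ^+ 2 * s ^+ 4).
  set c := 31 * M ^+ 3; have c2 : 0 <= c ^+ 2 * s ^+ 4.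
    by apply: mulr_ge0 => //; exact: sqr_ge0.
  (* Young's inequality, balanced so that exactly half of the penalty is spent. *)
  apply: (@le_trans _ _ (\sum_(i < I) (imb x i ^+ 2 / s ^+ 2 / 2 + c ^+ 2 * s ^+ 4))).
    rewrite mulr_sumr; apply: ler_sum => i _.
    rewrite -(real_normK (num_real (imb x i))); set y := `|imb x i|.
    rewrite -subr_ge0 (_ : _ - _ = (y / s - c * s ^+ 2) ^+ 2 / 2 + c ^+ 2 * s ^+ 4 / 2);
      last by field; rewrite gt_eqF.
    by apply: addr_ge0; apply: divr_ge0 => //; exact: sqr_ge0.
  rewrite big_split/= sumr_const card_ord -!mulr_suml lerD2l -mulr_natl.
  exact: ler_wpM2r.
have h3 : M * ((31 * M ^+ 3) ^+ 2 * s ^+ 4) <= M * (31 * M ^+ 3) ^+ 2 * s ^+ 6.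
  rewrite mulrA ler_wpM2l//; last exact: ler_weXn2l.
  by apply: mulr_ge0; [exact: ltW | exact: sqr_ge0].
have h4 : 113 * M ^+ 4 * s ^+ 2 <= 113 * M ^+ 4 * s ^+ 6.
  rewrite ler_wpM2l//; last exact: ler_weXn2l.
  by rewrite mulr_ge0// exprn_ge0// ltW.
rewrite (_ : drift_constant * _ = M * (31 * M ^+ 3) ^+ 2 * s ^+ 6
  + 113 * M ^+ 4 * s ^+ 6 + (2 + M) * s ^+ 6); last by rewrite /drift_constant; ring.
lra.
Qed.

Lemma drift_lyapunov_le x :
  drift lambda mu p r (lyapunov lambda mu p r (s ^- 2)) x <=
  drift_constant * s ^+ 6 - s ^+ 7 * (~~ near_balance x)%:R.
Proof.
have s0 := s_gt0.
have [b|b] := boolP (bulk x); last first.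
  by rewrite /near_balance (negbTE b) mulr1; exact: drift_lyapunov_far.
apply: le_trans (drift_lyapunov_bulk b) _; rewrite lerD2l lerN2.
have D0 : 0 <= total_dissipation x.
  by apply: sumr_ge0 => i _; apply: sumr_ge0 => k _; exact: dissipation_ge0.
have V0 : 0 <= spread x by apply: sumr_ge0 => i _; exact: sqr_ge0.
have W0 : 0 <= spread x / s ^+ 2 / 2.
  by apply: divr_ge0 => //; apply: divr_ge0 => //; exact: sqr_ge0.
have [g|] := boolP (near_balance x); first by rewrite mulr0; lra.
rewrite /near_balance b /= mulr1 negb_and -ltNge => /orP[h|].
  apply: (@le_trans _ _ (spread x / s ^+ 2 / 2)); last by lra.
  rewrite ler_pdivlMr// ler_pdivlMr ?exprn_gt0//; apply: le_trans (ltW h).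
  by rewrite (_ : s ^+ 7 * 2 * s ^+ 2 = 2 * s ^+ 9)//; ring.
move=> /forallPn[i /forallPn[k]]; rewrite negb_imply -ltNge => /andP[hk /ltW h].
have := dissipation_le_total b hk; lra.
Qed.

(** * Product form of balanced states and linear programming duality *)

Variable N : nat.
Hypotheses (card_le : #|{: K}|%:R <= M)
  (size_le : forall a, a \in Kbar -> (\sum_(i < I) a i <= N)%N)
  (s_large : 7 * ln s + N%:R * (2 * M + 6) + 4 * M + 9 <= p * ln r).
Local Notation size a := (\sum_(j < I) a j)%N.
Local Notation L := ((1 - p) * ln r).

(** The bound [skew_le], of order [s], is too coarse here: dual variables must be accurate to [O(1)]
    relative to [L]. The bounds reflect that [X_(i)] lies between [theta / 2] and [5 * r]. *)
Lemma skew_bounds x i : bulk x -> - (L + 2 * M + 1) <= skew x i <= 2 * M + 5.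
Proof.
move=> b; have /andP[h1 h2] := bulk_available i b; have r0 := r_gt0.
have A1 := bulk_available_gt0 i b; have t0 : 0 < theta by rewrite powR_gt0.
have := ln_mu_le i; have := ln_lambda_le i.
rewrite !ler_norml => /andP[l1 l2] /andP[m1 m2].
have u1 : ln (available p x i)%:R <= ln 5 + ln r.
  by rewrite -lnM ?posrE ?ler_ln ?posrE ?mulr_gt0//; lra.
have u2 : p * ln r - ln 2 <= ln (available p x i)%:R.
  by rewrite -ln_powR -ln_div ?posrE// ler_ln ?posrE ?divr_gt0//; lra.
have l5 : ln 5 <= 5 - 1 :> R by apply: ln_le_sub1; lra.
have l2' : ln 2 <= 2 - 1 :> R by apply: ln_le_sub1; lra.
by apply/andP; split; lra.
Qed.

Lemma size_cfg_add a i : size (cfg_add a i) = (size a).+1.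
Proof.
rewrite (bigD1 i)//= [in RHS](bigD1 i)//= cfg_addE eqxx addn1 addSn.
by congr (_ + _).+1; apply: eq_bigr => j ji; rewrite cfg_addE (negbTE ji) addn0.
Qed.

Lemma sum_cfg_add (f : 'I_I -> R) a i :
  \sum_(j < I) (cfg_add a i j)%:R * f j = \sum_(j < I) (a j)%:R * f j + f i.
Proof.
rewrite (bigD1 i)//= [in RHS](bigD1 i)//= cfg_addE eqxx natrD mulrDl mul1r.
rewrite -addrA [f i + _]addrC addrA; congr (_ + _ + _).
by apply: eq_bigr => j ji; rewrite cfg_addE (negbTE ji) addn0.
Qed.

Lemma sum_cfg_le (f : 'I_I -> R) (c : R) a : 0 <= c -> a \in Kbar ->
  (forall i, f i <= c) -> \sum_(j < I) (a j)%:R * f j <= N%:R * c.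
Proof.
move=> c0 aK fc; apply: (@le_trans _ _ (\sum_(j < I) (a j)%:R * c)).
  by apply: ler_sum => j _; rewrite ler_wpM2l.
by rewrite -mulr_suml -natr_sum ler_wpM2r// ler_nat size_le.
Qed.

Lemma ln_zero_servers x : bulk x -> p * ln r - 1 <= ln (X0 x) <= p * ln r + 2.
Proof.
move=> b; have /andP[h1 h2] := bulk_zero_servers b.
have t0 : 0 < theta by rewrite powR_gt0// r_gt0.
have l3 : ln 3 <= 3 - 1 :> R by apply: ln_le_sub1; lra.
have l2' : ln 2 <= 2 - 1 :> R by apply: ln_le_sub1; lra.
have u1 : ln (X0 x) <= ln 3 + ln theta.
  by rewrite -lnM ?posrE ?ler_ln ?posrE ?mulr_gt0//; lra.
have u2 : ln theta - ln 2 <= ln (X0 x).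
  by rewrite -ln_div ?posrE// ler_ln ?posrE ?divr_gt0//; lra.
by rewrite ln_powR in u1 u2; apply/andP; split; lra.
Qed.

(* Near balance the occupancies are of product form up to bounded factors:
   climbing one customer at a time from the zero-servers, every upward flow
   stays of order at least [r `^ p], so the dissipation bound [s ^+ 7] forces
   the ratio of opposite flows into [[expR (-1), expR 1]]. *)
Lemma near_balance_product_form x a : near_balance x -> a \in Kbar ->
  `|ln (occupancy p x a) - ln (X0 x) + \sum_(i < I) (a i)%:R * skew x i
     + ln (cfg_fact a)%:R| <= (size a)%:R.
Proof.
move=> /and3P[b _ /forallP bal].
have {}bal i a0 : a0 \in Kbar -> cfg_add a0 i \in Kbar -> diss x i a0 <= s ^+ 7.
  by move=> ha hb; have /forallP/(_ [` ha]%fset)/implyP/(_ hb) := bal i.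
have M0 := M_gt0.
move: {2 3}(size a) (erefl (size a)) => n; elim: n a => [|n IH] a an aK.
  have a0 : a = cfg0 I.
    apply/ffunP => i; rewrite ffunE; apply/eqP; rewrite -leqn0 -an.
    by rewrite (bigD1 i)//= leq_addr.
  rewrite a0 /occupancy eqxx subrr add0r big1 ?add0r; last first.
    by move=> i _; rewrite ffunE mul0r.
  by rewrite /cfg_fact big1 ?ln1 ?normr0// => j _; rewrite ffunE.
have [i ai] : exists i, (0 < a i)%N.
  apply: contrapT => h; move: an; rewrite big1// => i _; apply/eqP.
  by rewrite -leqn0 leqNgt; apply/negP => ai; apply: h; exists i.
have a'K : cfg_sub a i \in Kbar by exact: cfg_sub_in.
have aE := cfg_subK ai.
set a' := cfg_sub a i in a'K aE.
rewrite -aE in aK an *.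
have {}an : size a' = n by move: an; rewrite size_cfg_add => -[].
have {}IH := IH a' an a'K.
have nN : n%:R <= N%:R :> R by rewrite ler_nat -an size_le.
have T_le : \sum_(j < I) (a' j)%:R * skew x j <= N%:R * (2 * M + 5).
  apply: sum_cfg_le => //; first lra.
  by move=> j; have /andP[] := skew_bounds j b.
have /andP[_ sk] := skew_bounds i b.
have /andP[x0 _] := ln_zero_servers b.
have c0 := fact_le a'K.
have g1 : `|ln (down x i a' / up x i a')| <= 1.
  apply: dissipation_small; [exact: downflow_gt0|exact: upflow_gt0|].
  apply: le_trans (bal i a' a'K aK) _.
  have s0 := s_gt0; have s70 : 0 < s ^+ 7 by rewrite exprn_gt0.
  rewrite ler_pdivlMr// -ler_ln ?posrE ?upflow_gt0 ?mulr_gt0//.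
  rewrite lnM ?posrE// lnXn// -[ln s *+ 7]mulr_natl.
  have l4 : ln 4 <= 4 - 1 :> R by apply: ln_le_sub1; lra.
  have lu : ln (up x i a') = ln (occupancy p x a') + ln (mu i) - skew x i.
    by rewrite ln_upflow//; ring.
  have := ln_mu_le i; rewrite ler_norml => /andP[m1 _].
  move: IH; rewrite ler_norml => /andP[e1 _].
  (* This is where [s_large] comes from. At most [N] steps up lose at most [2 * M + 5] from the skew
     and 1 from the comparison of flows each; the rest covers one more skew, the factorial, [mu i],
     [X0] and [ln 4], so that [4 * s ^+ 7] is at most the upward flow. *)
  rewrite lu; move: s_large; lra.
rewrite sum_cfg_add cfg_fact_add natrM lnM ?posrE ?ltr0n ?cfg_fact_gt0//; last first.
  by rewrite cfg_addE eqxx addn1.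
move: g1; rewrite ln_flow_ratio// => g1.
rewrite -natr1; apply: le_trans (lerD IH g1).
apply: le_trans (ler_normD _ _).
by rewrite le_eqVlt; apply/orP; left; apply/eqP; congr (`|_|); ring.
Qed.

Local Notation Tk x a := (\sum_(i < I) (a i)%:R * - skew x i).

Lemma product_form_upper x a : near_balance x -> a \in Kbar ->
  Tk x a <= L + (M + N%:R + 6).
Proof.
move=> g aK; have /and3P[b _ _] := g.
have := near_balance_product_form g aK; rewrite ler_norml => /andP[h _].
have /andP[_ oc2] := bulk_occupancy a b; have /andP[oc1 _] := bulk_occupancy a b.
have /andP[x0 _] := ln_zero_servers b; have c0 := fact_le aK.
have sN : (size a)%:R <= N%:R :> R by rewrite ler_nat size_le.
have l5 : ln 5 <= 5 - 1 :> R by apply: ln_le_sub1; lra.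
have r0 := r_gt0.
have lo : ln (occupancy p x a) <= ln 5 + ln r.
  by rewrite -lnM ?posrE ?ler_ln ?posrE ?mulr_gt0//; lra.
under eq_bigr do rewrite mulrN; rewrite sumrN; lra.
Qed.

(** Approximate complementary slackness: the dual constraint of [k] misses tightness by at most
    [ln (r / X_k)] and a constant. *)
Lemma product_form_lower x (k : K) : near_balance x -> (0 < x k)%N ->
  ln ((x k)%:R / r) + L - (N%:R + 2) <= Tk x (val k).
Proof.
move=> g xk; have /and3P[b _ _] := g.
have /andP[k0 kK] : (val k != cfg0 I) && (val k \in Kbar).
  by rewrite -in_nonzero_configs; exact: valP.
have := near_balance_product_form g kK; rewrite ler_norml => /andP[_ h].
have /andP[_ x0] := ln_zero_servers b.
have c0 : 0 <= ln (cfg_fact (val k))%:R :> R by rewrite ln_ge0// ler1n cfg_fact_gt0.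
have sN : (size (val k))%:R <= N%:R :> R by rewrite ler_nat size_le.
have lo : ln (x k)%:R <= ln (occupancy p x (val k)).
  rewrite /occupancy (negbTE k0) count_servers_val ler_ln ?posrE ?ltr0n//.
  by rewrite ler_nat.
rewrite ln_div ?posrE ?ltr0n ?r_gt0//.
under eq_bigr do rewrite mulrN; rewrite sumrN; lra.
Qed.

(** Makes the logarithmic slack harmless: weighted by [y = X_k / r], it costs at most 1 per
    configuration. *)
Lemma xlnx_ge (y : R) : 0 < y -> -1 <= y * ln y.
Proof.
move=> y0; have h : ln y^-1 <= y^-1 - 1 by apply: ln_le_sub1; rewrite invr_gt0.
rewrite lnV ?posrE// in h.
have : y * (- ln y) <= y * (y^-1 - 1) by rewrite ler_pM2l.
by rewrite mulrBr divff ?gt_eqF// mulr1 mulrN; lra.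
Qed.

(** Cauchy-Schwarz bounds the square by [2 * M * s ^+ 9 <= s ^+ 10], and [s ^+ 5 = r / s ^+ 3]. *)
Lemma near_balance_imbalance x : near_balance x ->
  \sum_(i < I) `|imb x i| <= r / s ^+ 3.
Proof.
move=> /and3P[_ sp _]; have M0 := M_gt0; have s0 := s_gt0; have s1 := s_ge1.
have e : r / s ^+ 3 = s ^+ 5 by rewrite rE; field; rewrite gt_eqF.
have S0 : 0 <= \sum_(i < I) `|imb x i| by apply: sumr_ge0.
rewrite e -(@ler_pXn2r _ 2)// ?nnegrE ?exprn_ge0// ?(ltW s0)//.
apply: le_trans (sum_abs_sq_le _ M0 I_le) _.
apply: (@le_trans _ _ (M * (2 * s ^+ 9))); first by rewrite ler_wpM2l// ltW.
rewrite (_ : (s ^+ 5) ^+ 2 = s * s ^+ 9); last by ring.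
rewrite mulrA ler_wpM2r ?exprn_ge0 ?(ltW s0)//; move: s_ge; lra.
Qed.

Hypothesis L_ge1 : 1 <= L.

(* [- skew x i / L] is dual feasible for the linear program up to [O(1 / L)],
   and complementary slackness holds up to the same order. *)
Lemma near_balance_optimal x (u : {ffun K -> R}) : near_balance x ->
  lp_feasible (fun i => lambda i / mu i) u ->
  \sum_(k : K) fluid_scaled r x k <= \sum_(k : K) u k
    + (4 * M + 3 * N%:R + 10) / L + (2 * M + 6) / s ^+ 3.
Proof.
move=> g [uE u0]; have /and3P[b _ _] := g.
have M0 := M_gt0; have r0 := r_gt0; have L0 : 0 < L by move: L_ge1; lra.
have /andP[z1 z2] := bulk_customers b.
have s3 : 0 < s ^+ 3 by rewrite exprn_gt0// s_gt0.
set C1 : R := M + N%:R + 6; set C2 : R := N%:R + 2.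
have C10 : 0 <= C1 by rewrite /C1; have := ler0n R N; lra.
have C20 : 0 <= C2 by rewrite /C2; have := ler0n R N; lra.
(* Each nonzero configuration holds a customer, so the total load 1 bounds the number of servers.
   This bounds the effect of the dual infeasibility [C1]. *)
have sum_u : \sum_(k : K) u k <= 1.
  rewrite -hrho; under [leRHS]eq_bigr do rewrite -uE.
  rewrite exchange_big/=; apply: ler_sum => k _.
  have [i ki] := nonzero_config_pos k.
  rewrite (bigD1 i)//= -[leLHS]addr0; apply: lerD.
    by rewrite ler_peMl// ler1n.
  by apply: sumr_ge0 => j _; rewrite mulr_ge0.
have dual : \sum_(i < I) lambda i / mu i * - skew x i <=
    L * \sum_(k : K) u k + C1.
  under eq_bigr do rewrite -uE mulr_suml.
  rewrite exchange_big/=; apply: (@le_trans _ _ (\sum_(k : K) u k * (L + C1))).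
    apply: ler_sum => k _.
    under eq_bigr do rewrite mulrAC mulrC.
    rewrite -mulr_sumr ler_wpM2l// product_form_upper//.
    by have := valP k; rewrite in_nonzero_configs => /andP[].
  rewrite -mulr_suml mulrDr [_ * L]mulrC lerD2l; exact: ler_piMl.
have slack : L * \sum_(k : K) (x k)%:R / r - 2 * C2 - M <=
    \sum_(i < I) (customers x i)%:R / r * - skew x i.
  have -> : \sum_(i < I) (customers x i)%:R / r * - skew x i =
      \sum_(k : K) (x k)%:R / r * Tk x (val k).
    under eq_bigr do rewrite natr_sum mulr_suml mulr_suml.
    rewrite exchange_big/=; apply: eq_bigr => k _.
    by rewrite mulr_sumr; apply: eq_bigr => i _; rewrite natrM; ring.
  have h k : (x k)%:R / r * L - (x k)%:R / r * C2 - 1 <= (x k)%:R / r * Tk x (val k).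
    have [->|xk] := posnP (x k); first by rewrite !mul0r; lra.
    have y0 : 0 < (x k)%:R / r by rewrite divr_gt0// ltr0n.
    have := product_form_lower g xk; rewrite -/C2 => h.
    have := xlnx_ge y0.
    set y := (x k)%:R / r in y0 h *.
    have : y * (ln y + L - C2) <= y * Tk x (val k) by rewrite ler_pM2l.
    by rewrite (_ : y * (ln y + _ - _) = y * ln y + y * L - y * C2); [lra|ring].
  apply: (@le_trans _ _ (\sum_(k : K) ((x k)%:R / r * L - (x k)%:R / r * C2 - 1)));
    last exact: ler_sum.
  rewrite !sumrB -!mulr_suml sumr_const -[1 *+ _]/(_%:R) [L * _]mulrC.
  have tot : (\sum_(k : K) (x k)%:R) / r <= 2.
    rewrite ler_pdivrMr// -natr_sum.
    have : (\sum_(k : K) x k)%:R <= Z x by rewrite ler_nat sum_count_le.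
    lra.
  have : (\sum_(k : K) (x k)%:R) / r * C2 <= 2 * C2 by rewrite ler_wpM2r.
  by move: card_le; lra.
(* The fluid state satisfies the constraints only up to [imbalance / r]. The multipliers grow like
   [L], but after division by [L] the error is [O(s ^- 3)]. *)
have err : \sum_(i < I) (customers x i)%:R / r * - skew x i <=
    \sum_(i < I) lambda i / mu i * - skew x i + (L + 2 * M + 5) / s ^+ 3.
  rewrite -lerBlDl -sumrB.
  apply: (@le_trans _ _ (\sum_(i < I) `|imb x i| / r * (L + 2 * M + 5))).
    apply: ler_sum => i _; rewrite -mulrBl.
    apply: le_trans (ler_norm _) _; rewrite normrM; apply: ler_pM => //.
      rewrite (_ : _ - _ = imb x i / r); last first.
        by rewrite /imbalance mulrBl mulfK// gt_eqF.
      by rewrite normrM [X in _ * X]gtr0_norm// invr_gt0.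
    have /andP[k1 k2] := skew_bounds i b.
    by rewrite normrN ler_norml; apply/andP; split; lra.
  rewrite -!mulr_suml mulrC; apply: ler_wpM2l; first lra.
  rewrite ler_pdivrMr// mulrC; exact: near_balance_imbalance.
have fl : \sum_(k : K) fluid_scaled r x k = (\sum_(k : K) (x k)%:R / r).
  by apply: eq_bigr => k _; rewrite ffunE.
rewrite fl; set F := \sum_(k : K) (x k)%:R / r in slack *.
set U := \sum_(k : K) u k in dual *.
have fin : L * F <= L * U + (4 * M + 3 * N%:R + 10) + (L + 2 * M + 5) / s ^+ 3.
  by rewrite /C1 /C2 in dual slack; lra.
rewrite -(ler_pM2l L0); apply: le_trans fin _.
rewrite [leRHS](_ : _ = L * U + (4 * M + 3 * N%:R + 10) + L * (2 * M + 6) / s ^+ 3);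
  last by move: (L) L0 => l l0; field; rewrite !gt_eqF// s_gt0.
rewrite lerD2l ler_wpM2r ?invr_ge0 ?(ltW s3)//.
have : 2 * M + 5 <= L * (2 * M + 5) by apply: ler_peMl; [lra | exact: L_ge1].
lra.
Qed.

Lemma near_balance_feasible x i : near_balance x ->
  `|\sum_(k : K) (val k i)%:R * fluid_scaled r x k - lambda i / mu i| <= s ^- 3.
Proof.
move=> g; have r0 := r_gt0.
have -> : \sum_(k : K) (val k i)%:R * fluid_scaled r x k - lambda i / mu i =
    imb x i / r.
  rewrite /imbalance mulrBl mulfK ?gt_eqF//; congr (_ - _).
  rewrite natr_sum mulr_suml; apply: eq_bigr => k _.
  by rewrite ffunE natrM mulrA.
rewrite normrM [X in _ * X]gtr0_norm ?invr_gt0// ler_pdivrMr// mulrC.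
apply: le_trans (near_balance_imbalance g).
by rewrite (bigD1 i)//= lerDl sumr_ge0.
Qed.
End DriftBounds.

(** * Convergence to the optimal set *)

Section LinearProgramStability.
Context (R : realType) (I : nat) (Kbar : {fset config I}) (rho : 'I_I -> R).
Local Notation K := (nonzero_configs Kbar).
Local Notation point := (prod_topology (fun _ : K => R)).

Section RealValued.
Context (T : topologicalType).
Implicit Types f g : T -> R.

Lemma continuous_add f g :
  continuous f -> continuous g -> continuous (fun x => f x + g x).
Proof. by move=> cf cg x; apply: cvgD; [exact: cf | exact: cg]. Qed.

Lemma continuous_subc f (c : R) : continuous f -> continuous (fun x => f x - c).
Proof. by move=> cf x; apply: cvgB; [exact: cf | exact: cvg_cst]. Qed.

Lemma continuous_mulc f (c : R) : continuous f -> continuous (fun x => c * f x).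
Proof. by move=> cf x; apply: cvgM; [exact: cvg_cst | exact: cf]. Qed.

Lemma continuous_sqr f : continuous f -> continuous (fun x => f x ^+ 2).
Proof.
move=> cf; under eq_fun do rewrite expr2.
by move=> x; apply: cvgM; exact: cf.
Qed.

Lemma continuous_abs f : continuous f -> continuous (fun x => `|f x|).
Proof. by move=> cf x; apply: cvg_norm; exact: cf. Qed.

Lemma continuous_sqrt f : continuous f -> continuous (fun x => Num.sqrt (f x)).
Proof.
move=> cf x; apply: (continuous_comp (cf x)); exact: sqrt_continuous.
Qed.

Lemma continuous_sum (J : Type) (s : seq J) (f : J -> T -> R) :
  (forall j, continuous (f j)) -> continuous (fun x => \sum_(j <- s) f j x).
Proof.
move=> cf; elim: s => [|j s IH].
  by under eq_fun do rewrite big_nil; move=> x; exact: cvg_cst.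
by under eq_fun do rewrite big_cons; exact: continuous_add.
Qed.

End RealValued.

Lemma continuous_coordinate (k : K) : continuous (fun f : point => f k : R).
Proof. exact: proj_continuous. Qed.

Lemma euclidean_dist_ge0 (x y : {ffun K -> R}) : 0 <= euclidean_dist x y.
Proof. exact: sqrtr_ge0. Qed.

Lemma dist_to_set_le (x u : {ffun K -> R}) (U : set {ffun K -> R}) :
  U u -> dist_to_set x U <= euclidean_dist x u.
Proof.
move=> Uu; apply: ge_inf; last by exists u.
by exists 0 => _ [v _ <-]; exact: euclidean_dist_ge0.
Qed.

Lemma dist_to_set_ge0 (x : {ffun K -> R}) (U : set {ffun K -> R}) :
  0 <= dist_to_set x U.
Proof.
have [[u Uu]|empty] := pselect (exists u, U u).
  apply: lb_le_inf; first by exists (euclidean_dist x u), u.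
  by move=> _ [w _ <-]; exact: euclidean_dist_ge0.
rewrite /dist_to_set (_ : [set _ | _ in U] = set0) ?inf0//.
by apply/seteqP; split => // y [u Uu _]; apply: empty; exists u.
Qed.

(** Compactness: in a box, the points at distance at least [e] from every optimum form a compact
    set, on which a continuous measure [G] of infeasibility and suboptimality is positive, hence
    bounded below. *)
Lemma lp_stable (e : R) : 0 < e -> exists2 eta, 0 < eta &
  forall x : {ffun K -> R}, (forall k, 0 <= x k) ->
    (forall i, `|\sum_(k : K) (val k i)%:R * x k - rho i| <= eta) ->
    (forall u, lp_feasible rho u -> \sum_(k : K) x k <= \sum_(k : K) u k + eta) ->
    dist_to_set x (lp_optimal rho) <= e.
Proof.
(* Without an optimum the distance is the infimum of the empty set, which is 0 by default. *)
move=> e0; have [[u0 opt0]|empty] := pselect (exists u : {ffun K -> R}, lp_optimal rho u); last first.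
  exists 1 => // x _ _ _; rewrite /dist_to_set.
  have -> : [set euclidean_dist x u | u in lp_optimal rho] = set0.
    by apply/seteqP; split => // y [u uo _]; apply: empty; exists u.
  by rewrite inf0 ltW.
have [[uE upos] umin] := opt0.
pose v := \sum_(k : K) u0 k.
pose dist (f : point) (u : {ffun K -> R}) := Num.sqrt (\sum_(k : K) (f k - u k) ^+ 2).
pose far := [set f : point | forall k, `[0, v + 1]%classic (f k)] `&`
   \bigcap_(u in (@lp_optimal R I Kbar rho)) [set f : point | e <= dist f u].
(* The last two terms add up to twice the positive part of the excess cost, so that [G] vanishes
   exactly on optima among nonnegative points. *)
pose G (f : point) : R := \sum_(i < I) `|\sum_(k : K) (val k i)%:R * f k - rho i| +
   (`|\sum_(k : K) f k - v| + (\sum_(k : K) f k - v)).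
have csum : continuous (fun f : point => \sum_(k : K) f k).
  apply: (continuous_sum _ (f := fun k (f : point) => f k)) => k.
  exact: continuous_coordinate.
have cG : continuous G.
  have c1 : continuous (fun f : point => \sum_(k : K) f k - v).
    exact: continuous_subc.
  pose g1 (f : point) := \sum_(i < I) `|\sum_(k : K) (val k i)%:R * f k - rho i|.
  pose g2 (f : point) := `|\sum_(k : K) f k - v| + (\sum_(k : K) f k - v).
  have c2 : continuous g2.
    by apply: continuous_add => //; exact: continuous_abs.
  apply: (continuous_add (f := g1) (g := g2)) => //.
  apply: (continuous_sum _ (f := fun i (f : point) =>
    `|\sum_(k : K) (val k i)%:R * f k - rho i|)) => i.
  apply: continuous_abs; apply: continuous_subc.
  apply: (continuous_sum _ (f := fun (k : K) (f : point) => (val k i)%:R * f k)) => k.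
  apply: (continuous_mulc (f := fun f : point => f k)); exact: continuous_coordinate.
have cdist u : continuous (dist^~ u).
  apply: continuous_sqrt.
  apply: (continuous_sum _ (f := fun (k : K) (f : point) => (f k - u k) ^+ 2)) => k.
  apply: continuous_sqr; apply: (continuous_subc (f := fun f : point => f k)).
  exact: continuous_coordinate.
have cfar : compact far.
  apply: compact_closedI.
    exact: (tychonoff (fun k : K => @segment_compact R 0 (v + 1))).
  apply: closed_bigI => u _.
  have /continuous_closedP/(_ [set y | e <= y]) := cdist u.
  by apply; exact: closed_ge.
have v0 : 0 <= v by apply: sumr_ge0.
have [delta d0 Gd] : exists2 delta, 0 < delta & forall f, far f -> delta <= G f.
  have [[f0 ff0]|nofar] := pselect (exists f, far f); last first.
    by exists 1 => // f ff; exfalso; apply: nofar; exists f.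
  have [||c cfar' cmin] := @compact_EVT_min _ _ G far _ cfar.
  - by exists f0.
  - exact: continuous_subspaceT.
  exists (G c); last by move=> f ff; apply: cmin; rewrite inE.
  rewrite inE in cfar'; have [cbox cdist_ge] := cfar'.
  rewrite lt_neqAle; apply/andP; split; last first.
    apply: addr_ge0; first exact: sumr_ge0.
    by rewrite -lerBlDr sub0r -normrN ler_norm.
  apply/eqP => G0.
  have n1 : 0 <= \sum_(i < I) `|\sum_(k : K) (val k i)%:R * c k - rho i|.
    exact: sumr_ge0.
  have n2 : 0 <= `|\sum_(k : K) c k - v| + (\sum_(k : K) c k - v).
    by rewrite -lerBlDr sub0r -normrN ler_norm.
  have z1 : \sum_(i < I) `|\sum_(k : K) (val k i)%:R * c k - rho i| = 0.
    by move: G0 n1 n2; rewrite /G; lra.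
  have z2 : \sum_(k : K) c k <= v.
    move: G0 n1 n2; rewrite /G z1.
    have := normr_ge0 (\sum_(k : K) c k - v); lra.
  pose x : {ffun K -> R} := [ffun k => c k].
  have xopt : lp_optimal rho x.
    have xE : \sum_(k : K) x k = \sum_(k : K) c k.
      by apply: eq_bigr => k _; rewrite ffunE.
    split; last by move=> y /umin; rewrite xE; exact: le_trans.
    split=> [i|k]; last first.
      by rewrite ffunE; have /= := cbox k; rewrite in_itv/= => /andP[].
    have /eqP := z1; rewrite psumr_eq0// => /allP /(_ i).
    rewrite mem_index_enum normr_eq0 subr_eq0 => /(_ isT)/eqP <-.
    by apply: eq_bigr => k _; rewrite ffunE.
  have := cdist_ge x xopt; rewrite /= /dist big1 ?sqrtr0; first by rewrite leNgt e0.
  by move=> k _; rewrite ffunE subrr expr0n.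
have I0 : 0 < (I.+2%:R : R) by rewrite ltr0n.
(* The 1 keeps [x] inside the box of side [v + 1]. In [I.+2], each constraint contributes one [eta]
   to [G] and the doubled excess cost two, for a total of at most [delta / 2]. *)
exists (Num.min 1 (delta / I.+2%:R / 2)).
  by rewrite lt_min ltr01/= !divr_gt0.
set eta := Num.min _ _ => x x0 xfeas xmin.
have eta1 : eta <= 1 by rewrite /eta ge_min lexx.
have eta2 : I.+2%:R * eta <= delta / 2.
  by rewrite mulrC -ler_pdivlMr// /eta ge_min mulrAC lexx orbT.
rewrite leNgt; apply/negP => h.
have xv := xmin u0 (conj uE upos); rewrite -/v in xv.
have : delta <= G x.
  apply: Gd; split => [k /=|u uopt /=].
    rewrite in_itv/= x0/=; apply: (@le_trans _ _ (\sum_(k : K) x k)); last by lra.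
    by rewrite (bigD1 k)//= lerDl sumr_ge0.
  by apply: ltW; apply: lt_le_trans h _; exact: dist_to_set_le.
have G1 : \sum_(i < I) `|\sum_(k : K) (val k i)%:R * x k - rho i| <= I%:R * eta.
  apply: (@le_trans _ _ (\sum_(i < I) eta)); first by apply: ler_sum => i _.
  by rewrite sumr_const card_ord mulr_natl.
have eta0 : 0 <= eta by rewrite /eta le_min ler01/= !divr_ge0// ltW.
have G2 : `|\sum_(k : K) x k - v| + (\sum_(k : K) x k - v) <= 2 * eta.
  have [/ger0_norm -> |/ltr0_norm ->] := leP 0 (\sum_(k : K) x k - v); lra.
rewrite /G; move: eta2; rewrite -addn2 natrD mulrDl; lra.
Qed.
End LinearProgramStability.

(** * Concentration at a point implies convergence in distribution *)

Section ConvergenceToDirac.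
Context (R : realType).

(** Continuity at [a] controls [f y - f a] near [a], and boundedness controls it on the rare
    complement [A]. *)
Lemma cvg_in_distribution_dirac (nu : nat -> probability R R) (a : R) :
  (forall e delta : R, 0 < e -> 0 < delta -> \forall n \near \oo,
    (nu n (~` `[(a - e)%R, (a + e)%R]%classic) <= delta%:E)%E) ->
  cvg_in_distribution nu (\d_a).
Proof.
move=> hnu f cf [B [_ hB]].
set b : R := `|B| + 1.
have fb y : `|f y| <= b.
  by apply: (hB b) => //; rewrite /b (le_lt_trans (ler_norm B))// ltrDl.
have b0 : 0 < b by rewrite ltr_wpDl.
have mf : measurable_fun setT f by exact: continuous_measurable_fun.
have intf n : (nu n).-integrable setT (EFin \o f).
  apply: (@le_integrable _ _ _ (nu n) _ measurableT _ (cst b%:E)).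
  - exact/measurable_EFinP.
  - by move=> y _ /=; rewrite lee_fin (ger0_norm (ltW b0)).
  - exact: finite_measure_integrable_cst.
rewrite integral_dirac//; last exact/measurable_EFinP.
rewrite diracT mul1e.
apply/fine_cvgP; split.
  by apply: nearW => n; exact: (integrable_fin_num measurableT (intf n)).
apply/cvgrPdist_le => e e0.
have e20 : 0 < e / 2 by rewrite divr_gt0.
have /cvgrPdist_le/(_ _ e20) := cf a.
move=> /nbhs_ballP[d /= d0 hd].
have d20 : 0 < d / 2 by rewrite divr_gt0.
have del0 : 0 < e / (4 * b) by rewrite divr_gt0// mulr_gt0.
near=> n.
have hn : (nu n (~` `[(a - d / 2)%R, (a + d / 2)%R]%classic) <= (e / (4 * b))%:E)%E.
  by near: n; exact: hnu.
set A := ~` `[a - d / 2, a + d / 2]%classic in hn.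
have mA : measurable A by exact: measurableC.
have pt y : `|f y - f a| <= e / 2 + 2 * b * \1_A y.
  have [yA|yA] := pselect (A y).
    rewrite indicE mem_set// mulr1; apply: le_trans (ler_normB _ _) _.
    have := fb y; have := fb a; lra.
  rewrite indicE memNset// mulr0 addr0 -normrN opprB; apply: hd.
  move: yA; rewrite /A /= notE in_itv/= => /andP[h1 h2].
  by rewrite /ball/= ltr_norml; apply/andP; split; lra.
have nuT : (nu n) [set: R] = 1%E by exact: probability_setT.
have iA : (\int[nu n]_y (e / 2 + 2 * b * \1_A y)%:E)%E =
    ((e / 2)%:E + (2 * b)%:E * nu n A)%E.
  under eq_integral do rewrite EFinD.
  rewrite ge0_integralD//; first last.
  - by apply/measurable_EFinP; apply: measurable_funM => //; exact: measurable_indic.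
  - by move=> y _; rewrite lee_fin mulr_ge0// ?mulr_ge0// ltW.
  - by move=> y _; rewrite lee_fin ltW.
  rewrite integral_cst//; congr (_ + _)%E.
    by rewrite -[RHS]mule1; congr (_ * _)%E; exact: nuT.
  under eq_integral do rewrite EFinM.
  rewrite ge0_integralZl//; first last.
  - by rewrite lee_fin mulr_ge0// ltW.
  - by apply/measurable_EFinP; exact: measurable_indic.
  by rewrite integral_indic// setIT.
have eB : (\int[nu n]_y (f y - f a)%:E)%E = (\int[nu n]_y (f y)%:E - (f a)%:E)%E.
  under eq_integral do rewrite EFinB.
  rewrite integralB//; [|exact: intf|exact: finite_measure_integrable_cst].
  rewrite integral_cst//; congr (_ - _)%E.
  by rewrite -[RHS]mule1; congr (_ * _)%E; exact: nuT.
have : (`|\int[nu n]_y (f y - f a)%:E| <= e%:E)%E.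
  apply: le_trans (le_abse_integral _ _ _) _ => //.
    by apply/measurable_EFinP; apply: measurable_funB.
  apply: (@le_trans _ _ (\int[nu n]_y (e / 2 + 2 * b * \1_A y)%:E)%E).
    apply: ge0_le_integral => //.
    - by apply/measurable_EFinP; apply: measurableT_comp => //; apply: measurable_funB.
    - apply/measurable_EFinP; apply: measurable_funD => //.
      by apply: measurable_funM => //; exact: measurable_indic.
    - by move=> y _; rewrite lee_fin.
  rewrite iA; apply: (@le_trans _ _ ((e / 2)%:E + (2 * b)%:E * (e / (4 * b))%:E)%E).
    by rewrite leeD2l// lee_wpmul2l// lee_fin mulr_ge0// ltW.
  rewrite -EFinM -EFinD lee_fin.
  rewrite (_ : 2 * b * (e / (4 * b)) = e / 2); first by lra.
  by field; rewrite gt_eqF.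
rewrite eB -[X in (X - _)%E](fineK (integrable_fin_num measurableT (intf n))).
by rewrite -EFinB lee_fin -normrN opprB.
Unshelve. all: by end_near.
Qed.
End ConvergenceToDirac.

(** * Tail of the optimality gap under stationary laws *)

Section StationaryGap.
Context (R : realType) (I : nat) (Kbar : {fset config I}).
Hypothesis hK : feasible_configs Kbar.
Context (lambda mu : 'I_I -> R) (p : R).
Hypotheses (lambda_gt0 : forall i, 0 < lambda i) (mu_gt0 : forall i, 0 < mu i).
Hypothesis hrho : \sum_(i < I) lambda i / mu i = 1.
Hypotheses (p_gt : 7 / 8 < p) (p_lt1 : p < 1).
Local Notation K := (nonzero_configs Kbar).

Lemma le_sum_ge0 (J : finType) (f : J -> R) j :
  (forall i, 0 <= f i) -> f j <= \sum_i f i.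
Proof. by move=> f0; rewrite (bigD1 j)//= lerDl sumr_ge0. Qed.

Lemma parameters_bounded : exists (M : R) (N : nat),
  [/\ 1 <= M, I%:R <= M, (I * #|{: Kbar}|)%:R <= M & #|{: K}|%:R <= M] /\
  [/\ forall i, lambda i <= M, forall i, mu i <= M,
      forall i, `|ln (lambda i)| <= M & forall i, `|ln (mu i)| <= M] /\
  [/\ forall a i, a \in Kbar -> (a i)%:R <= M,
      forall a, a \in Kbar -> ln (cfg_fact a)%:R <= M &
      forall a : config I, a \in Kbar -> (\sum_(i < I) a i <= N)%N].
Proof.
pose N := (\sum_(k : Kbar) \sum_(i < I) val k i)%N.
have size_le a : a \in Kbar -> (\sum_(i < I) a i <= N)%N.
  by move=> aK; rewrite /N (bigD1 [` aK]%fset)//= leq_addr.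
have fact0 (k : Kbar) : 0 <= ln (cfg_fact (val k))%:R :> R.
  by rewrite ln_ge0// ler1n cfg_fact_gt0.
pose f i := lambda i + mu i + `|ln (lambda i)| + `|ln (mu i)|.
have f0 i : 0 <= f i by rewrite /f !addr_ge0// ltW.
have hf i : f i <= \sum_j f j by exact: le_sum_ge0.
pose F : R := \sum_(k : Kbar) ln (cfg_fact (val k))%:R.
have F0 : 0 <= F by exact: sumr_ge0.
have S0 : 0 <= \sum_j f j by exact: sumr_ge0.
pose c : R := I%:R + (I * #|{: Kbar}|)%:R + #|{: K}|%:R + N%:R.
exists (1 + \sum_j f j + F + c), N.
have n1 := ler0n R I; have n2 := ler0n R (I * #|{: Kbar}|).
have n3 := ler0n R #|{: K}|; have n4 := ler0n R N.
split; [|split].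
- by split; rewrite /c; lra.
- split=> i; have := hf i; have := lambda_gt0 i; have := mu_gt0 i;
  have := normr_ge0 (ln (lambda i)); have := normr_ge0 (ln (mu i)); rewrite /f /c; lra.
split=> // [a i aK|a aK].
  have : (a i)%:R <= N%:R :> R.
    by rewrite ler_nat (leq_trans _ (size_le a aK))// (bigD1 i)//= leq_addr.
  by rewrite /c; lra.
have : ln (cfg_fact a)%:R <= F by exact: (le_sum_ge0 [` aK]%fset fact0).
by rewrite /c; lra.
Qed.

(** The threshold [c] is uniform in the semigroup and in its stationary law, and so applies along
    any sequence of systems. *)
Lemma stationary_gap_tail (e delta : R) : 0 < e -> 0 < delta ->
  exists c : R, forall (r : R) (P : R -> R.-pker (state Kbar) ~> (state Kbar))
      (pi : probability (state Kbar) R),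
    0 < r -> c <= ln r -> ctmc_semigroup (grand_generator lambda mu p r) P ->
    stationary_distribution P pi ->
    (pi [set x | (e < fluid_gap (fun i => lambda i / mu i) r x)%R] <= delta%:E)%E.
Proof.
move=> e0 delta0; have p_gt' := p_gt; have p_lt1' := p_lt1.
have [eta eta0 stable] := lp_stable Kbar (fun i => lambda i / mu i) e0.
have [M [N [[M1 I_le pairs_le card_le] [[la_le mu_le lla_le lmu_le]
  [cfg_le fact_le size_le]]]]] := parameters_bounded.
have N0 := ler0n R N.
pose C3 := 4 * M + 3 * N%:R + 10.
pose D := drift_constant M.
have D0 : 0 <= D := drift_constant_ge0 M1.
have q1 : 0 < 8 * p - 7 by lra.
have q2 : 0 < 8 * (1 - p) by lra.
(* Lower bounds on [ln s], hence on [s]: [t1] yields [s_large], [t2] makes [L] large against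
   [C3 / eta], [t3] makes the [s ^- 3] errors at most [eta / 2], and [t4] brings the tail bound
   [D / s] below [delta]. The factor 8 below is [ln r = 8 * ln s]. *)
pose t1 := (N%:R * (2 * M + 6) + 4 * M + 9) / (8 * p - 7).
pose t2 := (1 + 2 * C3 / eta) / (8 * (1 - p)).
pose t3 := 2 * (2 * M + 6) / eta.
pose t4 := D / delta.
have t10 : 0 <= t1.
  apply: divr_ge0; last exact: ltW.
  by rewrite -addrA addr_ge0//; [rewrite mulr_ge0//; lra | lra].
have C30 : 0 <= C3 by rewrite /C3; lra.
have t20 : 0 <= t2.
  apply: divr_ge0; last exact: ltW.
  by apply: addr_ge0 => //; apply: divr_ge0; [lra | exact: ltW].
have t30 : 0 <= t3 by apply: divr_ge0; [lra | exact: ltW].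
have t40 : 0 <= t4 by apply: divr_ge0 => //; exact: ltW.
exists (8 * (100 * M + t1 + t2 + t3 + t4)) => r P pi r0 rc hP hpi.
pose s := r `^ 8^-1.
have s0 : 0 < s by rewrite powR_gt0.
have rE : r = s ^+ 8 by rewrite -powR_mulrn ?(ltW s0)// -powRrM mulVf// powRr1// ltW.
have lnr : ln r = 8 * ln s by rewrite /s ln_powR mulrA divff// mul1r.
have ls : 100 * M + t1 + t2 + t3 + t4 <= ln s by lra.
have lss : ln s <= s by exact: ln_le_self.
have s_ge : 100 * M <= s by lra.
have s1 : 1 <= s by lra.
have s_large : 7 * ln s + N%:R * (2 * M + 6) + 4 * M + 9 <= p * ln r.
  have : t1 <= ln s by lra.
  by rewrite /t1 ler_pdivrMr// lnr; lra.
have L2 : 1 + 2 * C3 / eta <= (1 - p) * ln r.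
  have : t2 <= ln s by lra.
  by rewrite /t2 ler_pdivrMr// lnr; lra.
have C3e : 0 <= 2 * C3 / eta by apply: divr_ge0; [lra | exact: ltW].
have L1 : 1 <= (1 - p) * ln r by lra.
have s3 : s <= s ^+ 3 by rewrite ler_eXnr.
have s30 : 0 < s ^+ 3 by rewrite exprn_gt0.
have h3 : (2 * M + 6) / s ^+ 3 <= eta / 2.
  rewrite ler_pdivrMr//; have : t3 <= s ^+ 3 by lra.
  by rewrite /t3 ler_pdivrMr//; lra.
have h3' : s ^- 3 <= eta.
  apply: le_trans (_ : (2 * M + 6) / s ^+ 3 <= _); last by lra.
  by rewrite ler_peMl ?invr_ge0 ?(ltW s30)//; lra.
have hL : C3 / ((1 - p) * ln r) <= eta / 2.
  rewrite ler_pdivrMr; last by lra.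
  have : 2 * C3 / eta <= (1 - p) * ln r by lra.
  by rewrite ler_pdivrMr//; lra.
apply: (@le_trans _ _ (pi [set x | ~~ near_balance lambda mu p r s x])).
  apply: le_measure; rewrite ?inE// => x /=; apply: contraTN => g.
  rewrite -leNgt; apply: stable => [k|i|u uf].
  - by rewrite ffunE divr_ge0// ltW.
  - apply: le_trans h3'.
    exact: (near_balance_feasible M1 I_le s_ge rE i g).
  - have := near_balance_optimal hK lambda_gt0 mu_gt0 hrho p_gt p_lt1 M1 I_le
      lla_le lmu_le fact_le s_ge rE card_le size_le s_large L1 g uf.
    by rewrite -/C3; lra.
have s70 : 0 < s ^+ 7 by rewrite exprn_gt0.
have Ds : 0 <= D * s ^+ 6 by rewrite mulr_ge0// exprn_ge0// ltW.
apply: le_trans (stationary_tail lambda_gt0 mu_gt0 r0 hP hpi _ Ds s70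
  (drift_lyapunov_le hK lambda_gt0 mu_gt0 hrho p_gt p_lt1 M1 I_le la_le mu_le
    lla_le lmu_le cfg_le fact_le pairs_le s_ge rE)) _.
  by move=> t; apply: lyapunov_coercive => //; rewrite invr_gt0 exprn_gt0.
rewrite lee_fin (_ : D * _ / _ = D / s); last by field; rewrite gt_eqF.
rewrite ler_pdivrMr// mulrC -ler_pdivrMr//.
by rewrite -/t4; lra.
Qed.

End StationaryGap.

Lemma kappa_ge1 (I : nat) (Kbar : {fset config I}) : (1 <= kappa Kbar)%N.
Proof. exact: leq_addr. Qed.

Theorem theorem4 (R : realType) (I : nat) (Kbar : {fset config I})
  (hK : feasible_configs Kbar)
  (lambda mu : 'I_I -> R)
  (hlambda : forall i, 0 < lambda i) (hmu : forall i, 0 < mu i)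
  (hrho : \sum_(i < I) lambda i / mu i = 1)
  (p : R) (hp0 : 0 < p) (hp1 : p < 1)
  (hp : 1 - (kappa Kbar)%:R * (1 - p) > 7 / 8)
  (r : nat -> R) (hr0 : forall n, 0 < r n) (hr_incr : increasing_seq r)
  (hr : r @ \oo --> +oo)
  (P : nat -> R -> R.-pker (state Kbar) ~> (state Kbar))
  (hP : forall n, ctmc_semigroup (grand_generator lambda mu p (r n)) (P n))
  (d : nat -> measure_display) (Omega : forall n, measurableType (d n))
  (Pr : forall n, probability (Omega n) R)
  (Xinf : forall n, {RV (Pr n) >-> (state Kbar)})
  (hX : forall n, stationary_distribution (P n) (distribution (Pr n) (Xinf n))) :
  cvg_in_distribution
    (fun n => distribution (Pr n)
       (fluid_gap (fun i => lambda i / mu i) (r n) \o Xinf n))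
    (\d_(0 : R)).
Proof.
(* As [kappa >= 1], [hp] gives [1 - p < 1 / 8]. *)
have p_gt : 7 / 8 < p.
  have : 1 <= (kappa Kbar)%:R :> R by rewrite ler1n kappa_ge1.
  nra.
apply: cvg_in_distribution_dirac => e delta e0 delta0.
have [c hc] := stationary_gap_tail hK hlambda hmu hrho p_gt hp1 e0 delta0.
near=> n.
have rc : c <= ln (r n).
  rewrite -[c]expRK ler_ln ?posrE ?expR_gt0//.
  by near: n; move/cvgryPge : hr; exact.
have mX (A : set (state Kbar)) : measurable (Xinf n @^-1` A).
  by rewrite -[X in measurable X]setTI; apply: measurable_funPT.
apply: le_trans (hc _ _ _ (hr0 n) rc (hP n) (hX n)).
set gap := fluid_gap _ _; set B := ~` _.
change (Pr n (Xinf n @^-1` (gap @^-1` B)) <=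
  Pr n (Xinf n @^-1` [set x | (e < gap x)%R]))%E.
apply: le_measure; rewrite ?inE; [exact: mX | exact: mX |].
(* The gap is nonnegative, so leaving [[- e, e]] means exceeding [e]. *)
move=> w /= gw; rewrite ltNge; apply/negP => h; apply: gw.
rewrite /= in_itv/= !add0r h andbT.
by apply: le_trans (dist_to_set_ge0 _ _); rewrite oppr_le0 ltW.
Unshelve. all: by end_near.
Qed.
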